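(* Let $R$ be a commutative Noetherian ring with identity, let $\mathfrak{b}\subseteq\mathfrak{a}$ be ideals of $R$, and let $M$ be a finitely generated $R$-module such that $f_{\mathfrak{a}}(M)\neq c_{\mathfrak{a}}^{\mathfrak{b}}(M)$. Then for every integer $r\in\mathbb{N}_0$, $$f_{\mathfrak{a}R_{\mathfrak{p}}}^{\mathfrak{b}R_{\mathfrak{p}}}(M_{\mathfrak{p}})>r\ \text{ for all }\mathfrak{p}\in\operatorname{Spec}(R)\iff f_{\mathfrak{a}}^{\mathfrak{b}}(M)>r.$$
   Context: $H^i_{\mathfrak{a}}(M)=\varinjlim_{n\ge 1}\operatorname{Ext}^i_R(R/\mathfrak{a}^n,M)$ is the $i$-th local cohomology module. The infimum of the empty set of integers is $\infty$. An $R$-module $X$ is called $\mathfrak{b}$-cofinite if $\operatorname{Supp}X\subseteq V(\mathfrak{b})$ and $\operatorname{Ext}^i_R(R/\mathfrak{b},X)$ is finitely generated for all $i\ge 0$. For a finitely generated $R$-module $M$ and ideals $\mathfrak{b}\subseteq\mathfrak{a}$: - $f_{\mathfrak{a}}(M)=\inf\{i\in\mathbb{N}_0\mid H^i_{\mathfrak{a}}(M)\text{ is not finitely generated}\}$; - $f_{\mathfrak{a}}^{\mathfrak{b}}(M)=\inf\{i\in\mathbb{N}_0\mid \mathfrak{b}^nH^i_{\mathfrak{a}}(M)\neq 0\text{ for all }n\in\mathbb{N}\}$, and $f_{\mathfrak{a}R_{\mathfrak{p}}}^{\mathfrak{b}R_{\mathfrak{p}}}(M_{\mathfrak{p}})$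 is the same invariant computed over $R_{\mathfrak{p}}$; - the $\mathfrak{b}$-cofiniteness dimension of $M$ relative to $\mathfrak{a}$ is $c_{\mathfrak{a}}^{\mathfrak{b}}(M)=\inf\{i\in\mathbb{N}_0\mid H^i_{\mathfrak{a}}(M)\text{ is not }\mathfrak{b}\text{-cofinite}\}$. *)

(* Defs.v *)
From HB Require Import structures.
From mathcomp Require Import all_boot all_algebra ring.
From mathcomp Require Import finmap boolp classical_sets functions cardinality fsbigop.

Set Implicit Arguments.
Unset Strict Implicit.
Unset Printing Implicit Defensive.

Import GRing.Theory.
Local Open Scope ring_scope.
Local Open Scope classical_set_scope.
Local Open Scope quotient_scope.

Section Submodules.
Variables (R : pzRingType) (V : lmodType R).

Definition submod (S : submodClosed V) := {x : V | x \in S}.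

HB.instance Definition _ (S : submodClosed V) := SubType.on (submod S).
HB.instance Definition _ (S : submodClosed V) := [Choice of submod S by <:].
HB.instance Definition _ (S : submodClosed V) :=
  [SubChoice_isSubLmodule of submod S by <:].

Definition in_submod (S : submodClosed V) x (Sx : x \in S) : submod S :=
  exist _ x Sx.

(* Intersection of all the submodules containing A. *)
Definition mod_span (A : {pred V}) : {pred V} := fun x =>
  `[< forall S : {pred V}, submod_closed S -> {subset A <= S} -> x \in S >].

Fact mod_span_closed A : submod_closed (mod_span A).
Proof.
split=> [|a u v /asboolP Au /asboolP Av]; apply/asboolP => S Scl AS.
  by case: Scl.
by case: (Scl) => _; apply; [exact: Au | exact: Av].
Qed.

HB.instance Definition _ A :=
  GRing.isSubmodClosed.Build R V (mod_span A) (mod_span_closed A).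

Definition finitely_generated := exists s : seq V, forall x, x \in mod_span [in s].

Section Quot.
Variable S : submodClosed V.

(* The library quotients zmodules by a zmodClosed predicate. *)
Definition closed_pred : {pred V} := fun x => x \in S.

Fact closed_pred_zmod_closed : zmod_closed closed_pred.
Proof. exact: GRing.submod_closedB (submodClosedP S). Qed.

HB.instance Definition _ :=
  GRing.isZmodClosed.Build V closed_pred closed_pred_zmod_closed.

Definition quotmod := Quotient.quot closed_pred.

HB.instance Definition _ := GRing.Zmodule.on quotmod.

Definition qproj (x : V) : quotmod := \pi_quotmod x.

Lemma qproj_eq x y : (qproj x == qproj y) = (x - y \in S).
Proof. by rewrite -Quotient.idealrBE. Qed.

Lemma qproj_surj q : {x | q = qproj x}.
Proof. by exists (repr q); rewrite /qproj reprK. Qed.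

Lemma qprojD : {morph qproj : x y / x + y}.
Proof. by move=> x y; rewrite /qproj !piE. Qed.

Definition qscale a (q : quotmod) : quotmod := qproj (a *: repr q).

Lemma qscaleE a x : qscale a (qproj x) = qproj (a *: x).
Proof.
apply/eqP; rewrite qproj_eq -scalerBr rpredZ // -qproj_eq.
by rewrite {1}/qproj reprK.
Qed.

Fact qscaleA a b q : qscale a (qscale b q) = qscale (a * b) q.
Proof. by have [x ->] := qproj_surj q; rewrite !qscaleE scalerA. Qed.

Fact qscale1 : left_id 1 qscale.
Proof. by move=> q; have [x ->] := qproj_surj q; rewrite qscaleE scale1r. Qed.

Fact qscaleDr : right_distributive qscale +%R.
Proof.
move=> a q r; have [x ->] := qproj_surj q; have [y ->] := qproj_surj r.
by rewrite -qprojD !qscaleE scalerDr qprojD.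
Qed.

Fact qscaleDl q : {morph qscale^~ q : a b / a + b}.
Proof.
by move=> a b; have [x ->] := qproj_surj q; rewrite !qscaleE scalerDl qprojD.
Qed.

HB.instance Definition _ := GRing.Zmodule_isLmodule.Build R quotmod
  qscaleA qscale1 qscaleDr qscaleDl.

Fact qproj_linear : linear qproj.
Proof. by move=> a x y; rewrite qprojD -qscaleE. Qed.

HB.instance Definition _ :=
  GRing.isLinear.Build R V quotmod *:%R qproj qproj_linear.

End Quot.
End Submodules.

Section Kernel.
Variables (R : pzRingType) (U V : lmodType R) (f : {linear U -> V}).

Definition kermod : {pred U} := fun x => f x == 0.

Fact kermod_closed : submod_closed kermod.
Proof.
split=> [|a x y]; rewrite !unfold_in ?linear0 // => /eqP fx /eqP fy.
by rewrite linearP fx fy scaler0 addr0.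
Qed.

HB.instance Definition _ :=
  GRing.isSubmodClosed.Build R U kermod kermod_closed.

Definition rangemod : {pred V} := fun y => `[< exists x, y = f x >].

Lemma rangemodP y : reflect (exists x, y = f x) (y \in rangemod).
Proof. exact: asboolP. Qed.

Fact rangemod_closed : submod_closed rangemod.
Proof.
split=> [|a x y /asboolP[u ->] /asboolP[v ->]]; apply/asboolP.
  by exists 0; rewrite linear0.
by exists (a *: u + v); rewrite linearP.
Qed.

HB.instance Definition _ :=
  GRing.isSubmodClosed.Build R V rangemod rangemod_closed.

End Kernel.

Section Restrict.
Variables (R : pzRingType) (U V : lmodType R) (f : {linear U -> V}).
Variables (S : submodClosed U) (T : submodClosed V).

Definition submod_map (fST : forall x, x \in S -> f x \in T) (x : submod S) :
  submod T := in_submod (fST _ (valP x)).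

Fact submod_map_linear fST : linear (submod_map fST).
Proof. by move=> a x y; apply: val_inj; rewrite linearP /= linearP. Qed.

HB.instance Definition _ fST := GRing.isLinear.Build R (submod S) (submod T)
  *:%R (submod_map fST) (submod_map_linear fST).

Definition quotmap of (forall x, x \in S -> f x \in T) :=
  fun q : quotmod S => qproj T (f (repr q)).

Lemma quotmapE fST x : quotmap fST (qproj S x) = qproj T (f x).
Proof.
apply/eqP; rewrite qproj_eq -linearB fST // -qproj_eq.
by rewrite {1}/qproj reprK.
Qed.

Fact quotmap_linear fST : linear (quotmap fST).
Proof.
move=> a q r; have [x ->] := qproj_surj q; have [y ->] := qproj_surj r.
by rewrite -linearP !quotmapE -linearP -linearP.
Qed.

HB.instance Definition _ fST := GRing.isLinear.Build R (quotmod S) (quotmod T)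
  *:%R (quotmap fST) (quotmap_linear fST).

End Restrict.

Section Subquotient.
Variables (R : pzRingType) (V : lmodType R) (Z B : submodClosed V).

Definition sub_pred : {pred submod Z} := fun x => val x \in B.

Fact sub_pred_closed : submod_closed sub_pred.
Proof.
split=> [|a x y xB yB]; first exact: (rpred0 B).
by rewrite unfold_in linearP; apply: rpredD; rewrite ?rpredZ.
Qed.

HB.instance Definition _ :=
  GRing.isSubmodClosed.Build R (submod Z) sub_pred sub_pred_closed.

(* Z / B, for B contained in Z; in general Z / (Z inter B). *)
Definition subquot : lmodType R := quotmod sub_pred.

End Subquotient.
Arguments sub_pred {R V} Z B.

Section SubquotientMap.
Variables (R : pzRingType) (U V : lmodType R) (f : {linear U -> V}).
Variables (Z B : submodClosed U) (Z' B' : submodClosed V).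
Hypothesis fZ : forall x, x \in Z -> f x \in Z'.
Hypothesis fB : forall x, x \in B -> f x \in B'.

Fact subquot_map_subproof x :
  x \in sub_pred Z B -> submod_map fZ x \in sub_pred Z' B'.
Proof. exact: fB. Qed.

Definition subquot_map : {linear subquot Z B -> subquot Z' B'} :=
  quotmap subquot_map_subproof.

End SubquotientMap.

Section DirectSum.
Variables (R : pzRingType) (I : choiceType) (E : I -> lmodType R).

Definition dprod := forall i, E i.

HB.instance Definition _ := Choice.on dprod.

Definition dprod_add (f g : dprod) : dprod := fun i => f i + g i.
Definition dprod_opp (f : dprod) : dprod := fun i => - f i.
Definition dprod_zero : dprod := fun=> 0.
Definition dprod_scale a (f : dprod) : dprod := fun i => a *: f i.

Fact dprod_addA : associative dprod_add.
Proof. by move=> f g h; apply: functional_extensionality_dep => i; exact: addrA. Qed.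
Fact dprod_addC : commutative dprod_add.
Proof. by move=> f g; apply: functional_extensionality_dep => i; exact: addrC. Qed.
Fact dprod_add0 : left_id dprod_zero dprod_add.
Proof. by move=> f; apply: functional_extensionality_dep => i; exact: add0r. Qed.
Fact dprod_addN : left_inverse dprod_zero dprod_opp dprod_add.
Proof. by move=> f; apply: functional_extensionality_dep => i; exact: addNr. Qed.

HB.instance Definition _ :=
  GRing.isZmodule.Build dprod dprod_addA dprod_addC dprod_add0 dprod_addN.

Fact dprod_scaleA a b f : dprod_scale a (dprod_scale b f) = dprod_scale (a * b) f.
Proof. by apply: functional_extensionality_dep => i; exact: scalerA. Qed.
Fact dprod_scale1 : left_id 1 dprod_scale.
Proof. by move=> f; apply: functional_extensionality_dep => i; exact: scale1r. Qed.
Fact dprod_scaleDr : right_distributive dprod_scale +%R.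
Proof. by move=> a f g; apply: functional_extensionality_dep => i; exact: scalerDr. Qed.
Fact dprod_scaleDl f : {morph dprod_scale^~ f : a b / a + b}.
Proof. by move=> a b; apply: functional_extensionality_dep => i; exact: scalerDl. Qed.

HB.instance Definition _ := GRing.Zmodule_isLmodule.Build R dprod
  dprod_scaleA dprod_scale1 dprod_scaleDr dprod_scaleDl.

Lemma dprod0E i : (0 : dprod) i = 0. Proof. by []. Qed.
Lemma dprodPE a (f g : dprod) i : (a *: f + g) i = a *: f i + g i.
Proof. by []. Qed.

Definition dfinsupp : {pred dprod} :=
  fun f => `[< finite_set [set i | f i != 0] >].

Fact dfinsupp_closed : submod_closed dfinsupp.
Proof.
split=> [|a f g /asboolP ff /asboolP fg]; apply/asboolP.
  rewrite (_ : mkset _ = set0) // -subset0 => i /=.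
  by rewrite dprod0E eqxx.
apply: (@sub_finite_set _ _ ([set i | f i != 0] `|` [set i | g i != 0])).
  move=> i /=; rewrite dprodPE => fgi; apply: contrapT => /not_orP[].
  move=> /negP/negPn/eqP fi /negP/negPn/eqP gi.
  by move: fgi; rewrite fi gi scaler0 addr0 eqxx.
by rewrite finite_setU.
Qed.

HB.instance Definition _ :=
  GRing.isSubmodClosed.Build R dprod dfinsupp dfinsupp_closed.

Definition dsum := submod dfinsupp.

HB.instance Definition _ := GRing.Lmodule.on dsum.

Fact dinj_subproof i (x : E i) : (dfwith (0 : dprod) x : dprod) \in dfinsupp.
Proof.
apply/asboolP; apply: (@sub_finite_set _ _ [set i]); last exact: finite_set1.
move=> j /=; apply: contra_neqP => /eqP; rewrite eq_sym => ji.
by rewrite dfwith_out.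
Qed.

Definition dinj i (x : E i) : dsum := in_submod (dinj_subproof x).

End DirectSum.

Section DirectLimit.
Variables (R : pzRingType) (E : nat -> lmodType R).
Variable t : forall n, {linear E n -> E n.+1}.

(* The relations identifying x in E n with its image t x in E (n+1). *)
Definition dirlim_rel : {pred dsum E} :=
  fun y => `[< exists n (x : E n), y = dinj x - dinj (t n x) >].

Definition dirlim := quotmod (mod_span dirlim_rel).

HB.instance Definition _ := GRing.Lmodule.on dirlim.

End DirectLimit.

Section Free.
Variables (R : pzRingType).

(* Free module on a set: finitely supported families of scalars. *)
Definition free_on (X : choiceType) : lmodType R := dsum (fun _ : X => R^o).

Definition fcoef (X : choiceType) (c : free_on X) (x : X) : R := val c x.
Definition fbasis (X : choiceType) (x : X) : free_on X :=
  @dinj R X (fun _ => R^o) x (1 : R^o).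

Variables (X : choiceType) (V : lmodType R) (g : X -> V).

(* The linear map extending g to the free module on X. *)
Definition free_lift (c : free_on X) : V :=
  \sum_(x \in [set: X]) (fcoef c x *: g x).

Lemma free_liftE (A : set X) (c : free_on X) :
  (forall x, fcoef c x != 0 -> A x) ->
  free_lift c = \sum_(x \in A) (fcoef c x *: g x).
Proof.
move=> cA; rewrite /free_lift -(fsbig_widen A [set: X]) // => x [_ /= nAx].
have [->|/cA//] := eqVneq (fcoef c x) 0; exact: scale0r.
Qed.

Lemma fcoef_finite (c : free_on X) : finite_set [set x | fcoef c x != 0].
Proof. exact: (asboolP (finite_set _) (valP c)). Qed.

Fact free_lift_linear : linear free_lift.
Proof.
move=> a c d; set A := [set x | fcoef c x != 0] `|` [set x | fcoef d x != 0].
have finA : finite_set A by rewrite finite_setU; split; exact: fcoef_finite.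
have fcoefP x : fcoef (a *: c + d) x = a * fcoef c x + fcoef d x by [].
have notA x : ~ A x -> fcoef c x = 0 /\ fcoef d x = 0.
  by move=> /not_orP[/negP/negPn/eqP-> /negP/negPn/eqP->].
rewrite !(@free_liftE A) //; last 3 first.
- by move=> x dx; right.
- by move=> x cx; left.
- move=> x; rewrite fcoefP; apply: contra_neqP => /notA[-> ->].
  by rewrite mulr0 addr0.
rewrite !fsbig_finite //= scaler_sumr -big_split /=.
by apply: eq_bigr => x _; rewrite fcoefP scalerDl scalerA.
Qed.

HB.instance Definition _ :=
  GRing.isLinear.Build R (free_on X) V *:%R free_lift free_lift_linear.

Lemma fcoef_basis (x y : X) : fcoef (fbasis x) y = (x == y)%:R.
Proof.
rewrite /fcoef /=; case: eqVneq => [<-|xy]; first by rewrite dfwith_in.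
by rewrite dfwith_out.
Qed.

Lemma free_lift_basis (x : X) : free_lift (fbasis x) = g x.
Proof.
rewrite (@free_liftE [set x]); first by rewrite fsbig_set1 fcoef_basis eqxx scale1r.
move=> y; rewrite fcoef_basis; have [->//|_] := eqVneq x y.
by rewrite eqxx.
Qed.

End Free.

Section FreeExt.
Variables (R : pzRingType) (X : choiceType) (V : lmodType R).

Lemma free_lift_id (c : free_on R X) : free_lift (@fbasis R X) c = c.
Proof.
apply: val_inj; apply: functional_extensionality_dep => y.
rewrite (@free_liftE _ _ _ _ [set x | fcoef c x != 0]) // fsbig_finite /=;
  last exact: fcoef_finite.
set A := fset_set _.
have fcoef_sum (s : seq X) : uniq s ->
    fcoef (\sum_(x <- s) fcoef c x *: fbasis R x) y = if y \in s then fcoef c y else 0.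
  elim: s => [|x s IHs] /=; first by rewrite big_nil.
  move=> /andP[xs us]; rewrite big_cons in_cons.
  rewrite [LHS](_ : _ = fcoef c x * fcoef (fbasis R x) y +
    fcoef (\sum_(x <- s) fcoef c x *: fbasis R x) y) // IHs // fcoef_basis.
  have [<-|xy] := eqVneq x y; first by rewrite (negPf xs) mulr1 addr0.
  by rewrite mulr0 add0r.
rewrite -/(fcoef _ y) (fcoef_sum A) ?finmap.fset_uniq // -/(fcoef c y).
case: ifPn => //; rewrite in_fset_set ?inE /=; last exact: fcoef_finite.
by move=> /negP/negP; rewrite notin_setE /= => /negP/negPn/eqP->.
Qed.

Lemma free_ext (f g : {linear free_on R X -> V}) :
  (forall x, f (fbasis R x) = g (fbasis R x)) -> f =1 g.
Proof.
move=> fg c; rewrite -(free_lift_id c).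
rewrite (@free_liftE _ _ _ _ [set x | fcoef c x != 0]) // fsbig_finite /=;
  last exact: fcoef_finite.
rewrite (linear_sum f) (linear_sum g).
by apply: eq_bigr => x _; rewrite !linearZ /= fg.
Qed.

End FreeExt.

(* The standard free resolution
   ... -> F_1 -> F_0 -> N -> 0, with F_n free on the underlying set of the n-th
   syzygy. It is functorial in N. *)

Section Syzygies.
Variable R : pzRingType.

Definition aug (N : lmodType R) : {linear free_on R N -> N} := free_lift (@id N).

Fixpoint syz (N : lmodType R) (n : nat) : lmodType R :=
  if n is m.+1 then submod (kermod (aug (syz N m))) else N.

Definition resol (N : lmodType R) n : lmodType R := free_on R (syz N n).

Definition resol_diff (N : lmodType R) n : {linear resol N n.+1 -> resol N n} :=
  (val : submod (kermod (aug (syz N n))) -> _) \o aug (syz N n.+1).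

Variables (N N' : lmodType R).

Definition free_map (f : N -> N') : {linear free_on R N -> free_on R N'} :=
  free_lift (fun x => fbasis R (f x)).

Lemma aug_free_map (f : {linear N -> N'}) c : aug N' (free_map f c) = f (aug N c).
Proof.
rewrite -[LHS]/((aug N' \o free_map f) c) -[RHS]/((f \o aug N) c).
by apply: free_ext => x /=; rewrite !free_lift_basis.
Qed.

Fact free_map_kernel (f : {linear N -> N'}) c :
  c \in kermod (aug N) -> free_map f c \in kermod (aug N').
Proof. by rewrite !unfold_in aug_free_map => /eqP->; rewrite linear0. Qed.

End Syzygies.

Section SyzMap.
Variables (R : pzRingType) (N N' : lmodType R) (f : {linear N -> N'}).

Fixpoint syz_map n : {linear syz N n -> syz N' n} :=
  if n is m.+1 then submod_map (free_map_kernel (syz_map m)) else f.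

Definition resol_map n : {linear resol N n -> resol N' n} :=
  free_map (syz_map n).

Lemma resol_mapE n c : resol_diff N' n (resol_map n.+1 c) = resol_map n (resol_diff N n c).
Proof. exact: (congr1 val (aug_free_map (syz_map n.+1) c)). Qed.

End SyzMap.

Section Hom.
Variables (R : comPzRingType) (U V : lmodType R).

Definition is_linear : {pred U -> V} := fun f => `[< linear f >].

Fact is_linear_closed : submod_closed is_linear.
Proof.
split=> [|a f g /asboolP lf /asboolP lg]; apply/asboolP => b x y.
  by rewrite /= scaler0 addr0.
rewrite -[LHS]/(a *: f (b *: x + y) + g (b *: x + y)) lf lg.
rewrite -[RHS]/(b *: (a *: f x + g x) + (a *: f y + g y)).
by rewrite !scalerDr !scalerA mulrC addrACA.
Qed.

HB.instance Definition _ :=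
  GRing.isSubmodClosed.Build R (U -> V) is_linear is_linear_closed.

Definition homod : lmodType R := submod is_linear.

Definition homod_fun (f : homod) : U -> V := val f.

Fact homod_fun_linear f : linear (homod_fun f).
Proof. exact: (asboolP _ (valP f)). Qed.

HB.instance Definition _ f :=
  GRing.isLinear.Build R U V *:%R (homod_fun f) (homod_fun_linear f).

End Hom.

Section Precomp.
Variables (R : comPzRingType) (U U' V : lmodType R) (g : {linear U -> U'}).

Fact precomp_subproof (f : homod U' V) : (homod_fun f \o g) \in @is_linear R U V.
Proof. by apply/asboolP => a x y /=; rewrite !linearP. Qed.

Definition precomp (f : homod U' V) : homod U V := in_submod (precomp_subproof f).

Fact precomp_linear : linear precomp.
Proof. by move=> a f h; apply: val_inj. Qed.

HB.instance Definition _ :=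
  GRing.isLinear.Build R (homod U' V) (homod U V) *:%R precomp precomp_linear.

End Precomp.
Arguments precomp {R U U'} V g f.

Section Ext.
Variables (R : comPzRingType).
Implicit Types N M : lmodType R.

Definition cochain i N M : lmodType R := homod (resol N i) M.

Definition codiff i N M : {linear cochain i N M -> cochain i.+1 N M} :=
  precomp M (resol_diff N i).

(* The coboundaries in degree i; the differential into degree 0 is zero. *)
Definition coboundary i N M : submodClosed (cochain i N M) :=
  match i with
  | 0 => rangemod (\0 : {linear cochain 0 N M -> cochain 0 N M})
  | j.+1 => rangemod (codiff j N M)
  end.

(* Ext^i(N, M), the i-th cohomology of Hom(F, M) for F the resolution of N. *)
Definition Ext i N M : lmodType R :=
  subquot (kermod (codiff i N M)) (coboundary i N M).

End Ext.

Section ExtMap.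
Variables (R : comPzRingType) (N N' : lmodType R) (f : {linear N -> N'}).
Variable M : lmodType R.

Definition cochain_map i : {linear cochain i N' M -> cochain i N M} :=
  precomp M (resol_map f i).

Lemma codiff_map i z :
  codiff i N M (cochain_map i z) = cochain_map i.+1 (codiff i N' M z).
Proof.
apply: val_inj; apply: funext => c.
exact: (congr1 (homod_fun z) (esym (resol_mapE f c))).
Qed.

Fact cocycle_map_subproof i z :
  z \in kermod (codiff i N' M) -> cochain_map i z \in kermod (codiff i N M).
Proof. by rewrite !unfold_in codiff_map => /eqP->; rewrite linear0. Qed.

Fact coboundary_map_subproof i z :
  z \in coboundary i N' M -> cochain_map i z \in coboundary i N M.
Proof.
case: i z => [|j] z /rangemodP[w ->]; apply/rangemodP.
  by exists 0; exact: linear0.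
by exists (cochain_map j w); exact: esym (codiff_map w).
Qed.

Definition Ext_map i : {linear Ext i N' M -> Ext i N M} :=
  subquot_map (@cocycle_map_subproof i) (@coboundary_map_subproof i).

End ExtMap.

(* Ideals, possibly improper, are the submodules of R^o. *)
Notation ideal R := (submodClosed (R : comPzRingType)^o).

Section Ideals.
Variable R : comPzRingType.

Definition fullmod (V : lmodType R) : {pred V} := fun=> true.

Fact fullmod_closed V : submod_closed (@fullmod V).
Proof. by []. Qed.

HB.instance Definition _ V :=
  GRing.isSubmodClosed.Build R V (@fullmod V) (@fullmod_closed V).

(* The submodule I S generated by the products of elements of I and S. *)
Definition smul (V : lmodType R) (I : ideal R) (S : {pred V}) : {pred V} :=
  mod_span (fun z => `[< exists2 x, x \in I & exists2 y, y \in S & z = x *: y >]).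

HB.instance Definition _ V I S := GRing.SubmodClosed.on (@smul V I S).

Fixpoint ideal_exp (I : ideal R) n : ideal R :=
  if n is m.+1 then smul I (ideal_exp I m) else @fullmod R^o.

Lemma ideal_exp_decr I n x : x \in ideal_exp I n.+1 -> x \in ideal_exp I n.
Proof.
move=> /asboolP; apply; first exact: submodClosedP.
by move=> _ /asboolP[a _ [y yI ->]]; exact: rpredZ.
Qed.

Definition noetherian := forall I : ideal R, finitely_generated (submod I).

(* The points of Spec R. The library's prime_idealr is restricted to rings with
   1 != 0. *)
Record prime_ideal := PrimeIdeal {
  prime_carrier :> ideal R;
  prime_proper : (1 : R) \notin prime_carrier;
  prime_mul : forall x y : R,
    x * y \in prime_carrier -> x \in prime_carrier \/ y \in prime_carrier
}.

End Ideals.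

Section LocalCohomology.
Variables (R : comPzRingType) (a : ideal R) (i : nat) (M : lmodType R).

Definition power_proj n :
    {linear quotmod (ideal_exp a n.+1) -> quotmod (ideal_exp a n)} :=
  quotmap (f := idfun) (@ideal_exp_decr R a n).

(* The limit of Ext^i(R/a^n, M) over n >= 1. *)
Definition loccoh : lmodType R :=
  @dirlim R (fun n => Ext i (quotmod (ideal_exp a n.+1)) M)
    (fun n => Ext_map (power_proj n.+1) M i).

End LocalCohomology.

Section Localization.
Variables (R : comPzRingType) (p : prime_ideal R).

Definition denom := {s : R | s \notin (p : ideal R)}.

HB.instance Definition _ := SubType.on denom.
HB.instance Definition _ := [Choice of denom by <:].

Definition dval (s : denom) : R := sval s.

Definition denom1 : denom := exist _ 1 (prime_proper p).

Fact denom_mul_subproof (s t : denom) : dval s * dval t \notin (p : ideal R).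
Proof.
apply/negP => /prime_mul[]; apply/negP; [exact: (valP s) | exact: (valP t)].
Qed.

Definition denom_mul (s t : denom) : denom :=
  exist _ (dval s * dval t) (denom_mul_subproof s t).

Lemma dval1 : dval denom1 = 1. Proof. by []. Qed.

Lemma dvalM s t : dval (denom_mul s t) = dval s * dval t. Proof. by []. Qed.

#[local] Arguments dval : simpl never.

Section Fractions.
Variable V : lmodType R.

Definition frac_equiv (f g : V * denom) : bool :=
  `[< exists u : denom,
        dval u *: (dval g.2 *: f.1 - dval f.2 *: g.1) = 0 >].

Lemma frac_equivP f g :
  reflect (exists u : denom,
             (dval u * dval g.2) *: f.1 = (dval u * dval f.2) *: g.1)
          (frac_equiv f g).
Proof.
apply: (iffP (asboolP _)) => -[u]; rewrite ?scalerBr ?scalerA => fg; exists u.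
  by apply/eqP; rewrite -subr_eq0 fg.
by rewrite scalerBr !scalerA fg subrr.
Qed.

Fact frac_equiv_is_equiv : equiv_class_of frac_equiv.
Proof.
split=> [f|f g|g f h].
- by apply/frac_equivP; exists denom1.
- by apply/idP/idP => /frac_equivP[u fg]; apply/frac_equivP; exists u.
move=> /frac_equivP[u fg] /frac_equivP[v gh]; apply/frac_equivP.
exists (denom_mul (denom_mul u v) g.2); rewrite !dvalM.
transitivity ((dval v * dval h.2 * (dval u * dval g.2)) *: f.1).
  by congr (_ *: _); ring.
rewrite -scalerA fg scalerA.
transitivity ((dval u * dval f.2 * (dval v * dval h.2)) *: g.1).
  by congr (_ *: _); ring.
by rewrite -scalerA gh scalerA; congr (_ *: _); ring.
Qed.

Canonical frac_equiv_equiv := EquivRelPack frac_equiv_is_equiv.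
Canonical frac_equiv_encModRel := defaultEncModRel frac_equiv.

Definition locmod := {eq_quot frac_equiv}.

HB.instance Definition _ := Choice.on locmod.
HB.instance Definition _ := EqQuotient.on locmod.

Definition loc_frac (x : V) (s : denom) : locmod := \pi_locmod (x, s).

Lemma frac_surj (q : locmod) : {x : V & {s : denom | q = loc_frac x s}}.
Proof.
by exists (repr q).1, (repr q).2; rewrite /loc_frac -surjective_pairing reprK.
Qed.

Lemma frac_eqP x s y t :
  loc_frac x s = loc_frac y t <->
  exists u : denom, (dval u * dval t) *: x = (dval u * dval s) *: y.
Proof.
rewrite /loc_frac; split => [/eqP|xy]; last apply/eqP.
  by rewrite piE => /frac_equivP.
by rewrite piE; apply/frac_equivP.
Qed.

Lemma frac_eq x s y t : dval t *: x = dval s *: y -> loc_frac x s = loc_frac y t.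
Proof. by move=> xy; apply/frac_eqP; exists denom1; rewrite dval1 !mul1r. Qed.

Definition loc_add (q r : locmod) : locmod :=
  loc_frac (dval (repr r).2 *: (repr q).1 + dval (repr q).2 *: (repr r).1)
       (denom_mul (repr q).2 (repr r).2).
Definition loc_opp (q : locmod) : locmod := loc_frac (- (repr q).1) (repr q).2.
Definition loc_zero : locmod := loc_frac 0 denom1.

Lemma repr_frac x s : loc_frac (repr (loc_frac x s)).1 (repr (loc_frac x s)).2 = loc_frac x s.
Proof. by rewrite /loc_frac -surjective_pairing reprK. Qed.

Lemma loc_addE x s y t : loc_add (loc_frac x s) (loc_frac y t) =
  loc_frac (dval t *: x + dval s *: y) (denom_mul s t).
Proof.
have /frac_eqP[u e] := repr_frac x s; have /frac_eqP[v e'] := repr_frac y t.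
rewrite /loc_add; case: repr e => x' s' /= e; case: repr e' => y' t' /= e'.
apply/frac_eqP; exists (denom_mul u v); rewrite !dvalM.
rewrite !scalerDr !scalerA; congr (_ + _).
  transitivity ((dval v * dval t * dval t' * (dval u * dval s)) *: x').
    by congr (_ *: _); ring.
  by rewrite -scalerA e scalerA; congr (_ *: _); ring.
transitivity ((dval u * dval s * dval s' * (dval v * dval t)) *: y').
  by congr (_ *: _); ring.
by rewrite -scalerA e' scalerA; congr (_ *: _); ring.
Qed.

Lemma loc_oppE x s : loc_opp (loc_frac x s) = loc_frac (- x) s.
Proof.
have /frac_eqP[u e] := repr_frac x s.
rewrite /loc_opp; case: repr e => x' s' /= e.
by apply/frac_eqP; exists u; rewrite !scalerN e.
Qed.

Fact loc_addA : associative loc_add.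
Proof.
move=> q r w; have [x [s ->]] := frac_surj q; have [y [t ->]] := frac_surj r.
have [z [v ->]] := frac_surj w; rewrite !loc_addE; apply: frac_eq; rewrite /= ?dvalM ?dval1.
rewrite !scalerDr !scalerA addrA.
by congr (_ *: _ + _ *: _ + _ *: _); ring.
Qed.

Fact loc_addC : commutative loc_add.
Proof.
move=> q r; have [x [s ->]] := frac_surj q; have [y [t ->]] := frac_surj r.
by rewrite !loc_addE addrC; apply: frac_eq; rewrite !dvalM mulrC.
Qed.

Fact loc_add0 : left_id loc_zero loc_add.
Proof.
move=> q; have [x [s ->]] := frac_surj q; rewrite loc_addE; apply: frac_eq; rewrite /= ?dvalM ?dval1.
by rewrite scaler0 add0r mul1r scale1r.
Qed.

Fact loc_addN : left_inverse loc_zero loc_opp loc_add.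
Proof.
move=> q; have [x [s ->]] := frac_surj q; rewrite loc_oppE loc_addE.
by apply: frac_eq; rewrite scalerN addNr !scaler0.
Qed.

HB.instance Definition _ :=
  GRing.isZmodule.Build locmod loc_addA loc_addC loc_add0 loc_addN.

Lemma fracD x s y t :
  loc_frac x s + loc_frac y t = loc_frac (dval t *: x + dval s *: y) (denom_mul s t).
Proof. exact: loc_addE. Qed.

End Fractions.

(* The localized ring, with (r / s) (x / t) = (r x) / (s t). *)
Definition locring := locmod R^o.

HB.instance Definition _ := GRing.Zmodule.on locring.

Definition loc_scale (V : lmodType R) (c : locmod R^o) (q : locmod V) : locmod V :=
  loc_frac (((repr c).1 : R) *: (repr q).1) (denom_mul (repr c).2 (repr q).2).

Lemma loc_scaleE (V : lmodType R) (r : R^o) s (x : V) t :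
  loc_scale (loc_frac r s) (loc_frac x t) = loc_frac ((r : R) *: x) (denom_mul s t).
Proof.
have /frac_eqP[u e] := repr_frac r s; have /frac_eqP[v e'] := repr_frac x t.
rewrite /loc_scale; case: repr e => r' s' /= e; case: repr e' => x' t' /= e'.
have {}e : dval u * dval s * r' = dval u * dval s' * r := e.
apply/frac_eqP; exists (denom_mul u v); rewrite !dvalM !scalerA.
transitivity ((dval u * dval s * r' * (dval v * dval t)) *: x').
  by congr (_ *: _); ring.
by rewrite e -scalerA e' scalerA; congr (_ *: _); ring.
Qed.

Section LocScale.
Variable V : lmodType R.

Fact loc_scaleA (b c : locring) (q : locmod V) :
  loc_scale b (loc_scale c q) = loc_scale (loc_scale b c) q.
Proof.
have [x [s ->]] := frac_surj b; have [y [t ->]] := frac_surj c.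
have [z [v ->]] := frac_surj q; rewrite (loc_scaleE y t z) (loc_scaleE x s y).
rewrite !loc_scaleE; apply: frac_eq; rewrite !dvalM.
rewrite !scalerA; congr (_ *: _). by rewrite /GRing.scale /=; ring.
Qed.

Fact loc_scale1 (q : locmod V) : loc_scale (loc_frac (1 : R^o) denom1) q = q.
Proof.
have [x [s ->]] := frac_surj q; rewrite loc_scaleE; apply: frac_eq; rewrite /= ?dvalM ?dval1.
by rewrite scale1r mul1r.
Qed.

Fact loc_scaleDr (c : locring) (q r : locmod V) :
  loc_scale c (q + r) = loc_scale c q + loc_scale c r.
Proof.
have [x [s ->]] := frac_surj c; have [y [t ->]] := frac_surj q.
have [z [v ->]] := frac_surj r; rewrite fracD !loc_scaleE fracD.
apply: frac_eq; rewrite /= ?dvalM ?dval1 !scalerDr !scalerA.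
by congr (_ *: _ + _ *: _); ring.
Qed.

Fact loc_scaleDl (q : locmod V) (b c : locring) :
  loc_scale (b + c) q = loc_scale b q + loc_scale c q.
Proof.
have [x [s ->]] := frac_surj b; have [y [t ->]] := frac_surj c.
have [z [v ->]] := frac_surj q; rewrite fracD !loc_scaleE fracD.
apply: frac_eq; rewrite !dvalM -[_ *: x]/(dval t * x) -[_ *: y]/(dval s * y).
rewrite !scalerDl !scalerDr !scalerA.
by congr (_ *: _ + _ *: _); ring.
Qed.

End LocScale.

Definition loc_mul (b c : locring) : locring := loc_scale b c.
Definition loc_one : locring := loc_frac (1 : R^o) denom1.

Fact loc_mulA : associative loc_mul.
Proof. by move=> b c d; exact: loc_scaleA. Qed.

Fact loc_mulC : commutative loc_mul.
Proof.
move=> b c; have [x [s ->]] := frac_surj b; have [y [t ->]] := frac_surj c.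
rewrite /loc_mul !loc_scaleE; apply: frac_eq; rewrite !dvalM /GRing.scale /=; ring.
Qed.

Fact loc_mul1 : left_id loc_one loc_mul.
Proof. exact: loc_scale1. Qed.

Fact loc_mulDl : left_distributive loc_mul +%R.
Proof. by move=> b c d; exact: loc_scaleDl. Qed.

HB.instance Definition _ := GRing.Zmodule_isComPzRing.Build locring
  loc_mulA loc_mulC loc_mul1 loc_mulDl.

HB.instance Definition _ (V : lmodType R) :=
  GRing.Zmodule_isLmodule.Build locring (locmod V)
    (@loc_scaleA V) (@loc_scale1 V) (@loc_scaleDr V) (fun q => @loc_scaleDl V q).

(* The extended ideal I R_p. *)
Definition loc_ideal (I : ideal R) : ideal locring :=
  mod_span ((fun q => `[< exists2 x, x \in I & q = loc_frac x denom1 >])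
        : {pred locring^o}).

End Localization.

Section Cofinite.
Variable R : comPzRingType.

Definition in_supp (X : lmodType R) (p : prime_ideal R) : Prop :=
  exists q : locmod p X, q <> 0.

(* p is in V(b). *)
Definition in_variety (b : ideal R) (p : prime_ideal R) : Prop :=
  {subset b <= (p : ideal R)}.

Definition cofinite (b : ideal R) (X : lmodType R) : Prop :=
  (forall p, in_supp X p -> in_variety b p) /\
  forall i, finitely_generated (Ext i (quotmod b) X).

End Cofinite.

(* Infimum of a set of natural numbers; None stands for infinity. *)
Definition inf_nat (P : nat -> Prop) : option nat :=
  if pselect (exists i, `[< P i >]) is left exP then Some (ex_minn exP) else None.

Definition inf_gt (d : option nat) (r : nat) : Prop :=
  if d is Some k then (r < k)%N else True.

Section Dimensions.
Variable R : comPzRingType.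

(* f_a(M) *)
Definition fin_dim (a : ideal R) (M : lmodType R) : option nat :=
  inf_nat (fun i => ~ finitely_generated (loccoh a i M)).

(* f_a^b(M) *)
Definition rel_fin_dim (a b : ideal R) (M : lmodType R) : option nat :=
  inf_nat (fun i => forall n, (0 < n)%N ->
    exists2 z, z \in smul (ideal_exp b n) (@fullmod R (loccoh a i M)) & z != 0).

(* c_a^b(M) *)
Definition cofin_dim (a b : ideal R) (M : lmodType R) : option nat :=
  inf_nat (fun i => ~ cofinite b (loccoh a i M)).

End Dimensions.

(* Main.v *)
Require Import Defs.
From HB Require Import structures.
From mathcomp Require Import all_boot all_algebra ring.
From mathcomp Require Import boolp classical_sets functions cardinality.

Set Implicit Arguments.
Unset Strict Implicit.
Unset Printing Implicit Defensive.

Import GRing.Theory.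
Local Open Scope ring_scope.

(** Write [H i] for the local cohomology module of [M] in degree [i]. The
    invariant [rel_fin_dim] exceeds [r] exactly when every [H i] with [i <= r]
    is killed by a power of [b], so the theorem compares two conditions: being
    killed by a power of [b] globally, and at each prime.

    The two conditions are linked through cocycles. Each [R/a^n] has a
    resolution by free modules of finite rank, that is, a sequence of matrices;
    an element of [H i] comes from a tuple of elements of [M] that these matrices
    make a cocycle, and a scalar kills it iff the multiplied tuple becomes a
    coboundary for some larger [n] ([loccoh_annihilators]). The same matrices
    read in [R_p] resolve the localised quotients, so both sides of this
    criterion can be transported by clearing denominators. Hence annihilation by
    [b^n] passes from [H i] to the local cohomology over [R_p]
    ([killed_by_localize]), and back up to a denominator for each element
    ([localize_killed_by]). The first fact is one implication of the theorem.

    For the other, let [X] be a module such that [torsion_by b X], the copy of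
    [Hom(R/b, X)] in [X], is finitely generated. If at each prime [X] is killed
    by some power of [b], then one power kills [X] ([local_global_killed]): every
    associated prime of [X] contains [b], so it is an associated prime of
    [torsion_by b X], and finitely many primes suffice to detect nonzero elements
    there. Then [X] is finitely generated, being filtered by its submodules
    killed by powers of [b] ([fg_of_killed]), and it is [b]-cofinite
    ([supp_of_killed], [fg_Ext]).

    Now [torsion_by b X] is finitely generated as soon as [X] is finitely
    generated or [b]-cofinite ([fg_torsion_by]). So under the local hypothesis
    the two properties are equivalent for [H i] with [i <= r]; if one of these
    modules failed to be finitely generated, the first to fail would be at once
    the finiteness dimension and the cofiniteness dimension, which are distinct
    by assumption. Hence all of them are finitely generated, and each is killed
    by a power of [b]. *)

(** * Finitely generated submodules *)

Lemma linear_map0 (R : comPzRingType) (U V : lmodType R) (f : U -> V) : linear f -> f 0 = 0.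
Proof. by move=> lf; have := lf (-1) 0 0; rewrite scaler0 addr0 scaleN1r addNr. Qed.

Section Span.
Variables (R : comPzRingType) (V : lmodType R).
Implicit Types (K : {pred V}) (s t : seq V) (x y : V).

Lemma zero_submod_closed : submod_closed (fun v : V => v == 0).
Proof.
split=> [|a u v]; first exact: eqxx.
by rewrite !unfold_in => /eqP-> /eqP->; rewrite scaler0 addr0.
Qed.

Lemma mem_mod_span (A : {pred V}) x : x \in A -> x \in mod_span A.
Proof. by move=> Ax; apply/asboolP => S _; apply. Qed.

Lemma mod_span_min (A K : {pred V}) :
  submod_closed K -> {subset A <= K} -> {subset mod_span A <= K}.
Proof. by move=> Kcl AK x /asboolP; apply. Qed.

Lemma mod_spanS (A B : {pred V}) : {subset A <= B} -> {subset mod_span A <= mod_span B}.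
Proof.
move=> AB; apply: mod_span_min => [|x /AB]; first exact: mod_span_closed.
exact: mem_mod_span.
Qed.

Lemma mod_span_cons x s y :
  y \in mod_span [in x :: s] -> exists r : R, y - r *: x \in mod_span [in s].
Proof.
pose K : {pred V} := fun z => `[< exists r : R, z - r *: x \in mod_span [in s] >].
suff /[apply] /asboolP : {subset mod_span [in x :: s] <= K} by [].
apply: mod_span_min => [|z].
  split=> [|c u v /asboolP[r ur] /asboolP[q vq]]; apply/asboolP.
    by exists 0; rewrite scale0r subr0 rpred0.
  exists (c * r + q); rewrite scalerDl -scalerA opprD addrACA -scalerBr.
  by rewrite rpredD ?rpredZ.
rewrite [z \in _]in_cons => /orP[/eqP-> | zs]; apply/asboolP.
  by exists 1; rewrite scale1r subrr rpred0.
by exists 0; rewrite scale0r subr0; apply: mem_mod_span.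
Qed.

(** Stated for a predicate, so that membership can be replaced by an equivalent
    condition without changing the module that the generators live in. *)
Definition fg_sub K :=
  exists2 s : seq V, {subset s <= K} & {subset K <= mod_span [in s]}.

Lemma eq_fg_sub K K' : K =i K' -> fg_sub K -> fg_sub K'.
Proof.
move=> KK [s sK Ks]; exists s => x; rewrite -KK; [exact: sK | exact: Ks].
Qed.

Lemma fg_fullmod : finitely_generated V <-> fg_sub (@fullmod R V).
Proof. by split=> [[s sV]|[s _ sV]]; exists s => // x; exact: sV. Qed.

Definition noeth_mod := forall K, submod_closed K -> fg_sub K.

End Span.

Lemma mod_span_map (R : comPzRingType) (U V : lmodType R) (f : U -> V)
  (lf : linear f) (s : seq U) x :
  x \in mod_span [in s] -> f x \in mod_span [in map f s].
Proof.
have f0 := linear_map0 lf.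
suff /[apply] /asboolP : {subset mod_span [in s] <= (fun x => `[< f x \in mod_span [in map f s] >])} by [].
apply: mod_span_min => [|u us].
  split=> [|c u v /asboolP fu /asboolP fv]; apply/asboolP.
    by rewrite f0 rpred0.
  by rewrite lf rpredD ?rpredZ.
by apply/asboolP; apply: mem_mod_span; apply: map_f.
Qed.

Section Finiteness.
Variable R : comPzRingType.
Implicit Types U V : lmodType R.

Lemma fg_submod V (S : submodClosed V) :
  finitely_generated (submod S) <-> fg_sub (S : {pred V}).
Proof.
have lval : linear (val : submod S -> V) by move=> c x y; exact: linearP.
split=> [[s sS]|[s sS Ss]].
  exists (map val s) => [_ /mapP[x _ ->]|x Sx]; first exact: valP.
  exact: (mod_span_map lval (sS (in_submod Sx))).
exists (pmap insub s) => x; have := Ss _ (valP x).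
pose K : {pred V} := fun v => `[< exists2 y : submod S,
  y \in mod_span [in pmap insub s] & v = val y >].
suff sK : {subset mod_span [in s] <= K}.
  by move=> /sK/asboolP[y ys /val_inj->].
apply: mod_span_min => [|v vs].
  split=> [|c u v /asboolP[y ys ->] /asboolP[z zs ->]]; apply/asboolP.
    by exists 0; rewrite ?rpred0.
  by exists (c *: y + z); rewrite ?linearP //= rpredD ?rpredZ.
apply/asboolP; exists (in_submod (sS v vs)) => //; apply: mem_mod_span.
rewrite [_ \in _]mem_pmap; apply/mapP; exists v => //; rewrite insubT.
  exact: sS.
by move=> Sv; congr Some; exact: val_inj.
Qed.

Lemma fg_image U V (f : U -> V) (lf : linear f) (K : {pred U}) :
  fg_sub K -> fg_sub (fun v => `[< exists2 u, u \in K & v = f u >]).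
Proof.
move=> [s sK Ks]; exists (map f s) => [_ /mapP[u us ->]|_ /asboolP[u uK ->]].
  by apply/asboolP; exists u; rewrite ?sK.
exact: mod_span_map lf _ _ (Ks u uK).
Qed.

(** Lifts of generators of the image, together with generators of the part
    killed by [f], generate [K]. *)
Lemma fg_extension U V (f : U -> V) (lf : linear f) (K : {pred U}) :
    submod_closed K ->
    fg_sub (fun v => `[< exists2 u, u \in K & v = f u >]) ->
    fg_sub (fun u => (u \in K) && (f u == 0)) ->
  fg_sub K.
Proof.
move=> Kcl [s sK Ks] [t tK Kt].
have [K0 KP] := Kcl.
have /choice[g gP] : forall v, exists u, v \in s -> u \in K /\ v = f u.
  move=> v; case: (boolP (v \in s)) => [/sK/asboolP[u uK ->]|_]; last by exists 0.
  by exists u.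
have f0 := linear_map0 lf.
pose L : {pred V} := fun v => `[< exists u, [/\ u \in K,
  u \in mod_span [in map g s] & v = f u] >].
have sL : {subset mod_span [in s] <= L}.
  apply: mod_span_min => [|v vs].
    split=> [|c _ _ /asboolP[y [yK ys ->]] /asboolP[z [zK zs ->]]]; apply/asboolP.
      by exists 0; rewrite ?f0 ?K0 ?rpred0.
    by exists (c *: y + z); rewrite lf KP // rpredD ?rpredZ.
  have [gK gE] := gP v vs.
  by apply/asboolP; exists (g v); split=> //; apply: mem_mod_span; apply: map_f.
exists (map g s ++ t) => [u|u uK].
  rewrite mem_cat => /orP[/mapP[v vs ->]|/tK]; first by case: (gP v vs).
  by rewrite unfold_in => /andP[].
have /Ks/sL/asboolP[w [wK ws fuw]] : f u \in (fun v => `[< exists2 u, u \in K & v = f u >]).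
  by apply/asboolP; exists u.
have subK : u - w \in (fun u => (u \in K) && (f u == 0)).
  rewrite unfold_in -[u - w]addrC -scaleN1r KP //= lf fuw.
  by rewrite scaleN1r addNr.
rewrite -[u](subrK w) rpredD //.
  by apply: mod_spanS (Kt _ subK) => x xt; rewrite [x \in _]mem_cat [x \in t]xt orbT.
by apply: mod_spanS ws => x xt; rewrite [x \in _]mem_cat [x \in map g s]xt.
Qed.

Hypothesis noethR : noetherian R.

Lemma fg_ideal (I : {pred R^o}) : submod_closed I -> fg_sub I.
Proof.
move=> Icl.
pose J : ideal R := HB.pack I (GRing.isSubmodClosed.Build R R^o I Icl).
exact: (iffLR (fg_submod J)) (noethR J).
Qed.

(** Induction on the number of generators: modulo all generators but one,
    [K] is the image of an ideal, and the part of [K] spanned by the other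
    generators is covered by the induction hypothesis. *)
Lemma fg_sub_span V (s : seq V) (K : {pred V}) :
  submod_closed K -> {subset K <= mod_span [in s]} -> fg_sub K.
Proof.
elim: s K => [|x s IHs] K Kcl Ks.
  suff s0 : {subset mod_span [in [::]] <= (fun z : V => z == 0)}.
    by exists [::] => // y /Ks/s0/eqP->; rewrite rpred0.
  by apply: mod_span_min => [|y]; first exact: zero_submod_closed.
have [K0 KP] := Kcl.
apply: (@fg_extension _ _ (qproj (mod_span [in s]))) => //.
- by move=> c u v; rewrite linearP.
- pose I : {pred R^o} := fun r => `[< exists2 k, k \in K & k - (r : R) *: x \in mod_span [in s] >].
  have Icl : submod_closed I.
    split=> [|c q r /asboolP[k kK kq] /asboolP[l lK lr]]; apply/asboolP.
      by exists 0; rewrite // scale0r subrr rpred0.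
    exists (c *: k + l); first exact: KP.
    rewrite scalerDl -scalerA opprD addrACA -scalerBr.
    by rewrite rpredD ?rpredZ.
  have lx : linear (fun r : R^o => qproj (mod_span [in s]) ((r : R) *: x)).
    by move=> c q r; rewrite scalerDl -scalerA linearP.
  apply: eq_fg_sub (fg_image lx (fg_ideal Icl)) => v.
  apply/asboolP/asboolP => [[r /asboolP[k kK kr] ->]|[k kK ->]].
    by exists k => //; apply/esym/eqP; rewrite qproj_eq.
  have [r kr] := mod_span_cons (Ks k kK).
  exists r; first by apply/asboolP; exists k.
  by apply/eqP; rewrite qproj_eq.
- apply: IHs => [|y].
    split=> [|c u v]; first by rewrite unfold_in K0 linear0 eqxx.
    rewrite !unfold_in => /andP[uK /eqP u0] /andP[vK /eqP v0].
    by apply/andP; split; [exact: KP | rewrite linearP /= u0 v0 scaler0 addr0].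
  rewrite unfold_in => /andP[_].
  by rewrite -(linear0 (qproj (mod_span [in s]))) qproj_eq subr0.
Qed.

Lemma fg_noeth_mod V : finitely_generated V -> noeth_mod V.
Proof. by move=> [s sV] K Kcl; apply: (@fg_sub_span _ s). Qed.

End Finiteness.

(** * Associated primes and local annihilation *)

(** Without a maximal element, dependent choice would give a strictly ascending
    chain; finitely many generators of its union all lie in one of its terms, so
    the chain would stop there. *)
Lemma noeth_max (R : comPzRingType) (V : lmodType R) (P : {pred V} -> Prop) (K0 : {pred V}) :
    noeth_mod V -> P K0 -> (forall K, P K -> submod_closed K) ->
  exists2 K, P K & forall K', P K' -> {subset K <= K'} -> {subset K' <= K}.
Proof.
move=> nV PK0 Pcl; apply: contrapT => nomax.
have step (K : {K | P K}) : exists K' : {K | P K},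
    {subset sval K <= sval K'} /\ exists2 x, x \in sval K' & x \notin sval K.
  case: K => K PK; apply: contrapT => nK; apply: nomax; exists K => // K' PK' KK' x xK'.
  apply: contrapT => /negP xK; apply: nK; exists (exist _ K' PK'); split=> //.
  by exists x.
have /choice[g gP] := step.
pose c n : {K | P K} := iter n g (exist _ K0 PK0).
have cS m n : (m <= n)%N -> {subset sval (c m) <= sval (c n)}.
  elim: n => [|n IHn]; first by rewrite leqn0 => /eqP->.
  rewrite leq_eqVlt => /orP[/eqP-> //|/IHn mn] x /mn.
  by case: (gP (c n)) => + _; apply.
pose U : {pred V} := fun x => `[< exists n, x \in sval (c n) >].
have Ucl : submod_closed U.
  split=> [|a u v /asboolP[m um] /asboolP[n vn]]; apply/asboolP.
    by exists 0; case: (Pcl _ (proj2_sig (c 0))).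
  exists (maxn m n); case: (Pcl _ (proj2_sig (c (maxn m n)))) => _; apply.
    by apply: (cS m) => //; exact: leq_maxl.
  by apply: (cS n) => //; exact: leq_maxr.
have [s sU Us] := nV U Ucl.
have [n sn] : exists n, {subset s <= sval (c n)}.
  elim: s sU {Us} => [|x s IHs] sU; first by exists 0.
  have [m sm] := IHs (fun y ys => sU y (mem_behead (s := x :: s) ys)).
  have /asboolP[n xn] := sU x (mem_head x s).
  exists (maxn m n) => y; rewrite in_cons => /orP[/eqP->|/sm].
    by apply: (cS n) => //; exact: leq_maxr.
  by apply: (cS m); exact: leq_maxl.
have [_ [x xc1 xc]] := gP (c n).
have /Us : x \in U by apply/asboolP; exists n.+1.
by move/(mod_span_min (Pcl _ (proj2_sig (c n))) sn); apply/negP.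
Qed.

Section Primes.
Variables (R : comPzRingType).
Hypothesis noethR : noetherian R.

Lemma noeth_ring : noeth_mod (R : comPzRingType)^o.
Proof. by move=> I; exact: fg_ideal. Qed.

(** Among the annihilators modulo [K] of the multiples of [x] that lie outside
    [K], a maximal one is prime: if [r * q] annihilates [c *: x] and [q] does
    not, then [r] annihilates [(q * c) *: x], whose annihilator is no larger. *)
Lemma exists_ass_prime (V : lmodType R) (K : {pred V}) (x : V) :
    submod_closed K -> x \notin K ->
  exists c : R, exists2 p : prime_ideal R, c *: x \notin K &
    forall r : R, ((r : R^o) \in (p : ideal R)) = (r *: (c *: x) \in K).
Proof.
move=> Kcl xK; have [K0 KP] := Kcl.
pose ann c : {pred R^o} := fun r => (r : R) *: (c *: x) \in K.
have annE c (r : R) : ((r : R^o) \in ann c) = (r *: (c *: x) \in K) by [].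
have ann_cl c : submod_closed (ann c).
  split=> [|a q r]; rewrite !annE ?scale0r // => qK rK.
  by rewrite scalerDl -[a *: q]/(a * q) -scalerA KP.
have [||_ [c cK ->] maxc] := @noeth_max R R^o
  (fun I => exists2 c, c *: x \notin K & I = ann c) (ann 1) noeth_ring.
- by exists 1; rewrite ?scale1r.
- by move=> _ [c _ ->].
pose p : ideal R := HB.pack (ann c)
  (GRing.isSubmodClosed.Build R R^o (ann c) (ann_cl c)).
have pE (r : R) : ((r : R^o) \in p) = (r *: (c *: x) \in K) by [].
have p1 : (1 : R^o) \notin p by rewrite pE scale1r.
have pM (r q : R) : (r * q : R^o) \in p -> (r : R^o) \in p \/ (q : R^o) \in p.
  move=> rq; case: (boolP ((q : R^o) \in p)) => [|qp]; [by right | left].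
  apply: (maxc (ann (q * c))).
  - by exists (q * c); rewrite // -scalerA.
  - move=> /= s'; pose s : R := s'; rewrite -/s !annE => sK.
    have -> : s *: ((q * c) *: x) = q *: (s *: (c *: x)) + 0.
      by rewrite addr0 !scalerA; congr (_ *: _); ring.
    exact: KP.
  - rewrite annE.
    have -> : r *: ((q * c) *: x) = (r * q) *: (c *: x) by rewrite !scalerA mulrA.
    exact: rq.
by exists c, (@PrimeIdeal R p p1 pM).
Qed.

(** Finitely many primes detect the nonzero elements of a noetherian module; a
    bound on [nn] over these primes is all that will be used of the finite set.
    By noetherian induction, let [K] be maximal among the submodules such that
    [V/K] lacks such a bound, and let [K'] be generated by [K] and an element
    [c *: v] whose annihilator modulo [K] is a prime [p]. Then [p] detects the
    elements of [K'] outside [K], and the bound for [V/K'] serves for the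
    elements outside [K']. *)
Lemma finite_detection (V : lmodType R) (nn : prime_ideal R -> nat) :
    noeth_mod V ->
  exists n, forall v : V, (forall p : prime_ideal R, (nn p <= n)%N ->
      exists2 u : R, (u : R^o) \notin (p : ideal R) & u *: v = 0) -> v = 0.
Proof.
move=> nV.
pose Q (K : {pred V}) := exists n, forall v : V,
  (forall p : prime_ideal R, (nn p <= n)%N ->
     exists2 u : R, (u : R^o) \notin (p : ideal R) & u *: v \in K) -> v \in K.
suff [n nP] : Q (fun v => v == 0).
  by exists n => v vp; apply/eqP/nP => p /vp[u up /eqP uv]; exists u.
apply: contrapT => nQ.
have [|K [Kcl nK] maxK] := @noeth_max R V (fun K => submod_closed K /\ ~ Q K) _ nV (conj (zero_submod_closed V) nQ).
  by move=> K [].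
have [K0 KP] := Kcl.
have [v vK] : exists v, v \notin K.
  by apply: contrapT => /forallNP vK; apply: nK; exists 0 => v _; apply/negPn/negP/vK.
have [c [p cv pE]] := exists_ass_prime Kcl vK.
pose K' : {pred V} := fun w => `[< exists r : R, w - r *: (c *: v) \in K >].
have K'cl : submod_closed K'.
  split=> [|a w z /asboolP[r wr] /asboolP[q zq]]; apply/asboolP.
    by exists 0; rewrite scale0r subrr.
  by exists (a * r + q); rewrite scalerDl -scalerA opprD addrACA -scalerBr KP.
have KK' : {subset K <= K'}.
  by move=> w wK; apply/asboolP; exists 0; rewrite scale0r subr0.
have [n nP] : Q K'.
  apply: contrapT => nQ'; case/negP: (cv); apply: (maxK K') => //.
  by apply/asboolP; exists 1; rewrite scale1r subrr.
case: nK; exists (maxn n (nn p)) => w wp.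
have /asboolP[r wr] : w \in K'.
  apply: nP => q qn; have [|u uq uw] := wp q; first by rewrite leq_max qn.
  by exists u => //; apply: KK'.
have [|u up uw] := wp p; first by rewrite leq_maxr.
have : (u * r : R^o) \in (p : ideal R).
  rewrite pE; have -> : (u * r) *: (c *: v) = (- u) *: (w - r *: (c *: v)) + u *: w.
    by rewrite scalerBr !scaleNr opprK addrAC addNr add0r !scalerA ?mulrA.
  exact: KP.
case/prime_mul => [/(negP up)//|]; rewrite pE => rK.
by rewrite -[w](subrK (r *: (c *: v))) -[w - _]scale1r KP.
Qed.

Lemma scaler_swap (V : lmodType R) (r q : R) (v : V) : r *: (q *: v) = q *: (r *: v).
Proof. by rewrite !scalerA mulrC. Qed.

Definition killed_by (I : ideal R) (X : lmodType R) : Prop :=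
  forall (r : R) (x : X), (r : R^o) \in I -> r *: x = 0.

(** This is a copy of [Hom(R/b, X)] inside [X]. *)
Definition torsion_by (b : ideal R) (X : lmodType R) : {pred X} :=
  fun x => `[< forall r : R, (r : R^o) \in b -> r *: x = 0 >].

Arguments torsion_by b X : clear implicits.

Lemma torsion_by_closed b X : submod_closed (torsion_by b X).
Proof.
split=> [|a x y /asboolP bx /asboolP byy]; apply/asboolP => r rb.
  by rewrite scaler0.
by rewrite scalerDr scaler_swap bx // byy // scaler0 addr0.
Qed.

HB.instance Definition _ b X :=
  GRing.isSubmodClosed.Build R X (torsion_by b X) (torsion_by_closed b X).

Lemma ideal_exp_le (b : ideal R) m n : (m <= n)%N -> {subset ideal_exp b n <= ideal_exp b m}.
Proof.
elim: n => [|n IHn]; first by rewrite leqn0 => /eqP->.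
by rewrite leq_eqVlt => /orP[/eqP->//|/IHn mn] x /ideal_exp_decr/mn.
Qed.

Lemma mem_ideal_expS (b : ideal R) n (x y : R) :
  (x : R^o) \in b -> (y : R^o) \in ideal_exp b n -> (x * y : R^o) \in ideal_exp b n.+1.
Proof.
move=> xb yb; apply: mem_mod_span; apply/asboolP.
by exists x => //; exists y.
Qed.

Lemma expr_ideal_exp (b : ideal R) n (x : R) :
  (x : R^o) \in b -> (x ^+ n : R^o) \in ideal_exp b n.
Proof. by move=> xb; elim: n => // n IHn; rewrite exprS mem_ideal_expS. Qed.

(** A nonzero element [w] of [b^n X] has a multiple [v] whose annihilator is a
    prime [p]. The local hypothesis at [p] forces [b] into [p], so that [v] lies
    in [torsion_by b X]; and [v] vanishes at every prime where [w] does. So [n]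
    only has to be large at the finitely many primes that detect the nonzero
    elements of [torsion_by b X]. *)
Lemma local_global_killed (b : ideal R) (X : lmodType R) :
    fg_sub (torsion_by b X) ->
    (forall p : prime_ideal R, exists n, forall (r : R) (x : X),
       (r : R^o) \in ideal_exp b n ->
       exists2 u : R, (u : R^o) \notin (p : ideal R) & u *: (r *: x) = 0) ->
  exists n, killed_by (ideal_exp b n) X.
Proof.
move=> /(iffRL (fg_submod (torsion_by b X)))/(fg_noeth_mod noethR) nT /choice[nn nnP].
have [n nP] := finite_detection nn nT.
exists n => r x rb; apply/eqP/negPn/negP => rx.
have [c [p vn0 pE]] := exists_ass_prime (zero_submod_closed X) rx.
set v := c *: (r *: x) in vn0 pE.
have bp (y : R) : (y : R^o) \in b -> (y : R^o) \in (p : ideal R).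
  move=> yb; have [u up] := nnP p (y ^+ nn p) v (expr_ideal_exp _ yb).
  rewrite scalerA => /eqP uv.
  have : (u * y ^+ nn p : R^o) \in (p : ideal R) by rewrite pE.
  case/prime_mul => [/(negP up)//|].
  elim: (nn p) => [|k IHk]; first by rewrite expr0 (negPf (prime_proper p)).
  by rewrite exprS => /prime_mul[].
have vT : v \in torsion_by b X.
  by apply/asboolP => y /bp; rewrite pE => /eqP.
suff : in_submod vT = 0 by move=> /(congr1 val)/= v0; move: vn0; rewrite v0 [_ \in _]eqxx.
apply: nP => q qn; have [u uq ux] := nnP q r x (ideal_exp_le qn rb).
exists u => //; apply: val_inj; rewrite /= /v (scaler_swap u).
by rewrite ux scaler0.
Qed.

(** [X] is filtered by the submodules [T m] killed by [b^m]. Multiplication by a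
    generator of [b] maps [T m.+1] to [T m]; taking the generators one at a time,
    the elements that they all kill form [torsion_by b X]. *)
Lemma fg_of_killed (b : ideal R) (X : lmodType R) n :
    fg_sub (torsion_by b X) -> killed_by (ideal_exp b n) X ->
  finitely_generated X.
Proof.
move=> fgT bX; apply/fg_fullmod.
have [s sb bs] := fg_ideal noethR (submodClosedP b).
pose T m := torsion_by (ideal_exp b m) X.
suff /(_ n) : forall m, fg_sub (T m).
  by apply: eq_fg_sub => x; apply/asboolP => r; exact: bX.
elim=> [|m IHm].
  exists [::] => // x /asboolP/(_ 1 isT); rewrite scale1r => ->.
  exact: (rpred0 (mod_span _)).
have [g gT Tg] := IHm.
pose U (t : seq R) : {pred X} := fun x =>
  (x \in T m.+1) && all (fun y => y *: x == 0) t.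
have UE t x : (x \in U t) = (x \in T m.+1) && all (fun y => y *: x == 0) t by [].
have Ucl t : submod_closed (U t).
  split=> [|a x y].
    by rewrite UE rpred0; apply/allP => y _; rewrite scaler0.
  rewrite !UE => /andP[xT /allP xt] /andP[yT /allP yt].
  apply/andP; split; first by rewrite rpredD ?rpredZ.
  apply/allP => z zt; rewrite scalerDr scaler_swap.
  by rewrite (eqP (xt z zt)) (eqP (yt z zt)) scaler0 addr0.
suff fgU (t : seq R) : {subset t <= (b : {pred R^o})} -> fg_sub (U t) -> fg_sub (T m.+1).
  apply: (fgU s sb); apply: eq_fg_sub fgT => x.
  apply/asboolP/andP => [bx|[_ /allP sx] r rb].
    split; last by apply/allP => y /sb/bx/eqP.
    apply/asboolP => r rb; apply: bx; move: (r : R^o) rb.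
    apply: mod_span_min => [|_ /asboolP[y yb [z _ ->]]]; first exact: submodClosedP.
    by rewrite -[y *: z]/((y : R) * (z : R)) mulrC; exact: (rpredZ (z : R) (yb : (y : R^o) \in b)).
  pose Z : {pred R^o} := fun r => `[< (r : R) *: x = 0 >].
  have /(_ _ (bs _ rb))/asboolP : {subset mod_span [in s : seq R^o] <= Z}; last by [].
  apply: mod_span_min => [|y ys]; last by apply/asboolP/eqP/sx.
  split=> [|a q t /asboolP qx /asboolP tx]; apply/asboolP; first exact: scale0r.
  by rewrite scalerDl -[a *: q]/((a : R) * (q : R)) -scalerA qx tx scaler0 addr0.
elim: t => [|y t IHt] tb fgt.
  by apply: eq_fg_sub fgt => x; rewrite unfold_in andbT.
apply: IHt => [z zt|]; first by apply: tb; rewrite in_cons zt orbT.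
have ly : linear (fun x : X => y *: x).
  by move=> a x z; rewrite scalerDr scaler_swap.
apply: (fg_extension ly (Ucl t)).
  apply: (@fg_sub_span R noethR X g) => [|_ /asboolP[x /andP[/asboolP xT _] ->]].
    split=> [|a _ _ /asboolP[x xU ->] /asboolP[z zU ->]]; apply/asboolP.
      by exists 0; rewrite ?scaler0 //; case: (Ucl t).
    by exists (a *: x + z); rewrite ?ly //; case: (Ucl t) => _; apply.
  apply: Tg; apply/asboolP => r rb; rewrite scalerA; apply: xT.
  by rewrite mulrC mem_ideal_expS // tb ?mem_head.
apply: eq_fg_sub fgt => x; rewrite [RHS]unfold_in !UE /=.
by rewrite -andbA [X in _ && X]andbC.
Qed.

Lemma supp_of_killed (b : ideal R) (X : lmodType R) n (p : prime_ideal R) :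
  killed_by (ideal_exp b n) X -> in_supp X p -> in_variety b p.
Proof.
move=> bX [q q0] y yb; apply: contrapT => /negP yp; apply: q0.
have [x [s ->]] := frac_surj q.
have ynp : (y ^+ n : R^o) \notin (p : ideal R).
  elim: n {bX} => [|n IHn]; first by rewrite expr0 prime_proper.
  by rewrite exprS; apply/negP => /prime_mul[]; apply/negP.
apply/frac_eqP; exists (exist _ (y ^+ n) ynp).
by rewrite scaler0 dval1 mulr1; exact: (bX _ _ (expr_ideal_exp _ yb)).
Qed.

End Primes.

Arguments torsion_by {R} b X.

(** * Projective resolutions and their comparison *)

Section Projective.
Variable R : comPzRingType.
Implicit Types P U V N M : lmodType R.

Definition projective P := forall U V (g : {linear U -> V}) (f : {linear P -> V}),
  (forall x, exists u, f x = g u) -> exists h : {linear P -> U}, forall x, g (h x) = f x.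

Lemma free_on_projective (X : choiceType) : projective (free_on R X).
Proof.
move=> U V g f fg; have /choice[u uP] := fun x : X => fg (fbasis R x).
exists (free_lift u : {linear _ -> _}) => x.
rewrite -[LHS]/((g \o free_lift u) x).
by apply: free_ext => y /=; rewrite free_lift_basis uP.
Qed.

Definition row_lift n M (x : 'I_n -> M) (v : 'rV[R]_n) : M := \sum_l v 0 l *: x l.

Fact row_lift_linear n M (x : 'I_n -> M) : linear (row_lift x).
Proof.
move=> a u v; rewrite /row_lift scaler_sumr -big_split /=.
by apply: eq_bigr => l _; rewrite !mxE scalerDl scalerA.
Qed.

HB.instance Definition _ n M (x : 'I_n -> M) :=
  GRing.isLinear.Build R 'rV[R]_n M *:%R (row_lift x) (row_lift_linear x).

Lemma row_liftE n M (f : {linear 'rV[R]_n -> M}) v :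
  f v = row_lift (fun l => f (delta_mx 0 l)) v.
Proof.
rewrite {1}[v]row_sum_delta linear_sum /=.
by apply: eq_bigr => l _; rewrite linearZ.
Qed.

Lemma row_lift_delta n M (x : 'I_n -> M) l : row_lift x (delta_mx 0 l) = x l.
Proof.
rewrite /row_lift (bigD1 l) //= mxE !eqxx scale1r big1 ?addr0 // => k kl.
by rewrite mxE (negPf kl) andbF scale0r.
Qed.

Lemma row_projective n : projective 'rV[R]_n.
Proof.
move=> U V g f fg; have /choice[u uP] := fun l : 'I_n => fg (delta_mx 0 l).
exists (row_lift u : {linear _ -> _}) => v.
rewrite (row_liftE f) [LHS]linear_sum /=.
by apply: eq_bigr => l _; rewrite linearZ /= uP.
Qed.

Record resolution N := Resolution {
  rterm :> nat -> lmodType R;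
  rdiff : forall n, {linear rterm n.+1 -> rterm n};
  raug : {linear rterm 0 -> N};
  raug_surj : forall y, exists x, y = raug x;
  raug_exact : forall x, raug x = 0 <-> exists y, x = rdiff 0 y;
  rdiff_exact : forall n x, rdiff n x = 0 <-> exists y, x = rdiff n.+1 y;
  rterm_proj : forall n, projective (rterm n)
}.

Section Comparison.
Variables (N N' : lmodType R) (P : resolution N) (Q : resolution N').

Record chain_lift (f : {linear N -> N'}) := ChainLift {
  clift :> forall n, {linear P n -> Q n};
  clift_aug : forall x, raug Q (clift 0 x) = f (raug P x);
  clift_diff : forall n x, rdiff Q n (clift n.+1 x) = clift n (rdiff P n x)
}.

Lemma rdiffK N0 (P0 : resolution N0) n x : rdiff P0 n (rdiff P0 n.+1 x) = 0.
Proof. by apply/rdiff_exact; exists x. Qed.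

(** Projectivity extends the lift one degree at a time, as soon as the part
    already built maps boundaries to boundaries. *)
Lemma some_chain_lift f : chain_lift f.
Proof.
pose good n (g : {linear P n -> Q n}) := forall x, exists y, g (rdiff P n x) = rdiff Q n y.
have [g0 g0P] : {g0 : {linear P 0 -> Q 0} | forall x, raug Q (g0 x) = f (raug P x)}.
  apply: cid; have := @rterm_proj _ P 0 _ _ (raug Q) (f \o raug P); apply => x.
  exact: raug_surj.
have good0 : good 0 g0.
  move=> x; apply/raug_exact; rewrite g0P.
  by rewrite (_ : raug P _ = 0) ?linear0 //; apply/raug_exact; exists x.
have step n (g : {g | @good n g}) : exists h : {h | @good n.+1 h},
    forall x, rdiff Q n (sval h x) = sval g (rdiff P n x).
  case: g => g gP /=.
  have [h hP] := @rterm_proj _ P n.+1 _ _ (rdiff Q n) (g \o rdiff P n) gP.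
  have hgood : good n.+1 h.
    by move=> x; apply/rdiff_exact; rewrite hP /= rdiffK linear0.
  by exists (exist _ h hgood).
pose G := fix G n : {g | @good n g} :=
  if n is m.+1 then sval (cid (step m (G m))) else exist _ g0 good0.
suff dG n x : rdiff Q n (sval (G n.+1) x) = sval (G n) (rdiff P n x).
  exact: (@ChainLift f (fun n => sval (G n)) g0P dG).
exact: (svalP (cid (step n (G n)))).
Qed.

End Comparison.

Definition cocycle N (P : resolution N) M i (z : P i -> M) : Prop :=
  forall x, z (rdiff P i x) = 0.

Definition cobound N (P : resolution N) M i : (P i -> M) -> Prop :=
  match i return (P i -> M) -> Prop with
  | 0 => fun z => forall x, z x = 0
  | j.+1 => fun z => exists w : {linear P j -> M}, forall x, z x = w (rdiff P j x)
  end.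

Lemma cocycleZD N (P : resolution N) M i r (z z' : {linear P i -> M}) :
  cocycle z -> cocycle z' -> cocycle (r \*: z \+ z' : {linear P i -> M}).
Proof. by move=> zc zc' x; rewrite /= zc zc' scaler0 addr0. Qed.

Lemma eq_cobound N (P : resolution N) M i (z z' : P i -> M) :
  z =1 z' -> cobound z -> cobound z'.
Proof.
case: i z z' => [|i] z z' zz /=; first by move=> z0 x; rewrite -zz.
by case=> w zw; exists w => x; rewrite -zz.
Qed.

Lemma cobound_comp N N' (P : resolution N) (Q : resolution N') f (F : chain_lift P Q f) M i
  (z : Q i -> M) : cobound z -> cobound (z \o F i).
Proof.
case: i z => [|i] z /=; first by move=> z0 x.
by case=> w zw; exists (w \o F i : {linear _ -> _}) => x /=; rewrite zw clift_diff.
Qed.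

(** The lifts [F] and [G] are homotopic. To pull back one cocycle of degree [i],
    the homotopy is needed only in the degrees [i] and [i - 1], so that no
    coherent choice of it is made: the induction only carries a map [h] on the
    [n]-th term for which [G - F - d h] vanishes on boundaries. *)
Lemma chain_lift_homotopy N N' (P : resolution N) (Q : resolution N') f g
    (F : chain_lift P Q f) (G : chain_lift P Q g) M i (z : {linear Q i -> M}) :
  f =1 g -> cocycle z -> cobound (fun x => z (G i x) - z (F i x)).
Proof.
move=> fg; pose D n : {linear P n -> Q n} := G n \- F n.
have DE n x : D n x = G n x - F n x by [].
have dD n x : rdiff Q n (D n.+1 x) = D n (rdiff P n x).
  by rewrite !DE linearB /= !clift_diff.
have [h0 h0P] : exists h : {linear P 0 -> Q 1}, forall x, rdiff Q 0 (h x) = D 0 x.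
  apply: rterm_proj => x; apply/raug_exact.
  by rewrite DE linearB /= !clift_aug fg subrr.
have step n (h : {linear P n -> Q n.+1}) :
    (forall x, D n (rdiff P n x) = rdiff Q n (h (rdiff P n x))) ->
  exists h' : {linear P n.+1 -> Q n.+2},
    forall x, rdiff Q n.+1 (h' x) = D n.+1 x - h (rdiff P n x).
  move=> Dh; apply: (@rterm_proj _ P n.+1 _ _ (rdiff Q n.+1) (D n.+1 \- (h \o rdiff P n))).
  by move=> x; apply/rdiff_exact; rewrite /= linearB /= dD Dh subrr.
have homotopy n : exists h : {linear P n -> Q n.+1},
    forall x, D n (rdiff P n x) = rdiff Q n (h (rdiff P n x)).
  elim: n => [|n [h hP]]; first by exists h0 => x; rewrite h0P.
  have [h' h'P] := step n h hP; exists h' => x.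
  by rewrite h'P rdiffK linear0 subr0.
case: i z => [|i] z zc /=.
  by move=> x; rewrite -linearB -DE -h0P zc.
have [h hP] := homotopy i; have [h' h'P] := step i h hP.
exists (z \o h : {linear _ -> _}) => x /=.
by rewrite -linearB -DE -[D _ x](subrK (h (rdiff P i x))) -h'P linearD /= zc add0r.
Qed.

Lemma aug_surj N (y : N) : exists x, y = aug N x.
Proof. by exists (fbasis R y); rewrite /aug /= free_lift_basis. Qed.

(** A name for this inclusion keeps [syz N n.+1] folded below: conversion between
    its nested unfoldings is very slow. *)
Definition syz_val N n (k : syz N n.+1) : resol N n := sval k.

Lemma resol_diffE N n (x : resol N n.+1) :
  resol_diff N n x = syz_val (aug (syz N n.+1) x).
Proof. by []. Qed.

Lemma syz_val_eq0 N n (k : syz N n.+1) : syz_val k = 0 <-> k = 0.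
Proof. by split=> [k0|->]; first exact: val_inj. Qed.

Lemma aug_eq0P N n (x : resol N n) :
  aug (syz N n) x = 0 <-> exists k : syz N n.+1, x = syz_val k.
Proof.
split=> [/eqP x0|[k ->]]; first by exists (@in_submod _ _ (kermod (aug (syz N n))) x x0).
by apply/eqP; exact: (svalP k).
Qed.

Lemma aug_exact N n (x : resol N n) :
  aug (syz N n) x = 0 <-> exists y, x = resol_diff N n y.
Proof.
split=> [/aug_eq0P[k ->]|[y ->]]; last by apply/aug_eq0P; exists (aug (syz N n.+1) y).
by have [y ->] := aug_surj k; exists y.
Qed.

Lemma resol_diff_exact N n (x : resol N n.+1) :
  resol_diff N n x = 0 <-> exists y, x = resol_diff N n.+1 y.
Proof. by rewrite resol_diffE syz_val_eq0; exact: aug_exact. Qed.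

Definition std_resolution N : resolution N :=
  @Resolution N (resol N) (resol_diff N) (aug N) (@aug_surj N) (@aug_exact N 0)
    (@resol_diff_exact N) (fun n => @free_on_projective (syz N n)).

Definition std_lift N N' (f : {linear N -> N'}) :
  chain_lift (std_resolution N) (std_resolution N') f.
Proof.
exists (resol_map f) => [x|n x]; first exact: aug_free_map.
exact: resol_mapE.
Defined.

Definition comp_lift N1 N2 N3 (P1 : resolution N1) (P2 : resolution N2) (P3 : resolution N3)
    (f : {linear N1 -> N2}) (g : {linear N2 -> N3})
    (F : chain_lift P1 P2 f) (G : chain_lift P2 P3 g) : chain_lift P1 P3 (g \o f).
Proof.
exists (fun n => G n \o F n : {linear _ -> _}) => [x|n x] /=.
  by rewrite !clift_aug.
by rewrite !clift_diff.
Defined.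

End Projective.

(** * Computing Ext from an arbitrary projective resolution *)

Section ExtClass.
Variable R : comPzRingType.
Implicit Types N M : lmodType R.

Fact linear_in_homod (U V : lmodType R) (z : {linear U -> V}) : (z : U -> V) \in @is_linear R U V.
Proof. by apply/asboolP => a x y; exact: linearP. Qed.

Definition to_homod (U V : lmodType R) (z : {linear U -> V}) : homod U V :=
  in_submod (linear_in_homod z).

Section Class.
Variables (N M : lmodType R) (i : nat).
Local Notation F := (std_resolution N).
Implicit Type z : {linear F i -> M}.

Fact cocycle_kermod z : cocycle z -> (to_homod z : cochain i N M) \in kermod (codiff i N M).
Proof. by move=> zc; apply/eqP/val_inj/funext => x; exact: zc. Qed.

Definition ext_class z (zc : cocycle z) : Ext i N M :=
  qproj _ (in_submod (cocycle_kermod zc)).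

Lemma ext_class_surj (h : Ext i N M) : exists z (zc : cocycle z), h = ext_class zc.
Proof.
have [[y yk] ->] := qproj_surj h.
have yc : cocycle (homod_fun y : {linear F i -> M}).
  by move=> x; move/eqP: (yk) => /(congr1 (fun g => homod_fun g x)).
exists (homod_fun y : {linear F i -> M}), yc.
by congr (qproj _ _); apply/val_inj/val_inj.
Qed.

Lemma ext_class_eq z z' (zc : cocycle z) (zc' : cocycle z') :
  ext_class zc = ext_class zc' <-> @cobound _ _ F M i (fun x => z x - z' x).
Proof.
have cobE (c : cochain i N M) : c \in coboundary i N M <->
    @cobound _ _ F M i (homod_fun c).
  case: i c => [|j] c.
    split=> [/rangemodP[w ->] x //|c0]; apply/rangemodP; exists 0.
    by apply: val_inj; apply: funext => x; exact: c0.
  split=> [/rangemodP[w ->]|[w wE]]; first by exists (homod_fun w).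
  apply/rangemodP; exists (to_homod w).
  by apply: val_inj; apply: funext => x; exact: wE.
have := cobE (to_homod z - to_homod z').
by move=> E; split=> [/eqP|/E zz]; last apply/eqP; rewrite qproj_eq // => /E.
Qed.

Lemma ext_classP a z z' (zc : cocycle z) (zc' : cocycle z')
    (zc'' : cocycle (a \*: z \+ z' : {linear F i -> M})) :
  a *: ext_class zc + ext_class zc' = ext_class zc''.
Proof.
rewrite /ext_class -linearP; congr (qproj _ _).
by apply/val_inj/val_inj.
Qed.

End Class.

Lemma ext_class_map N N' M (f : {linear N -> N'}) i (z : {linear std_resolution N' i -> M})
    (zc : cocycle z) (zc' : cocycle (z \o std_lift f i : {linear std_resolution N i -> M})) :
  Ext_map f M i (ext_class zc) = ext_class zc'.
Proof.
rewrite [LHS]quotmapE; congr (qproj _ _).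
by apply/val_inj/val_inj.
Qed.

End ExtClass.

Section ExtResolution.
Variable R : comPzRingType.
Implicit Types N M : lmodType R.

Lemma cocycle_comp N N' (P : resolution N) (Q : resolution N') f (F : chain_lift P Q f) M i
  (z : {linear Q i -> M}) : cocycle z -> cocycle (z \o F i : {linear P i -> M}).
Proof. by move=> zc x; rewrite /= -clift_diff zc. Qed.

Lemma eq_ext_class N M i (z z' : {linear std_resolution N i -> M})
    (zc : cocycle z) (zc' : cocycle z') :
  z =1 z' -> ext_class zc = ext_class zc'.
Proof.
move=> zz; apply/ext_class_eq.
apply: (@eq_cobound _ _ _ _ _ (fun=> 0)) => [v|]; first by rewrite zz subrr.
by case: (i) => [|j] //=; exists \0 => v.
Qed.

Lemma ext_class_lift N N' (Q : resolution N') (f g : {linear N -> N'})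
    (F : chain_lift (std_resolution N) Q f) (G : chain_lift (std_resolution N) Q g) M i
    (z : {linear Q i -> M}) (zc : cocycle z) :
  f =1 g -> ext_class (cocycle_comp F zc) = ext_class (cocycle_comp G zc).
Proof. by move=> fg; apply/ext_class_eq; apply: chain_lift_homotopy zc => x; rewrite fg. Qed.

Lemma ext_class_eq0 N M i (z : {linear std_resolution N i -> M}) (zc : cocycle z) :
  ext_class zc = 0 <-> cobound z.
Proof.
have c0 : cocycle (\0 : {linear std_resolution N i -> M}) by [].
have c1 : cocycle (-1 \*: \0 \+ \0 : {linear std_resolution N i -> M}).
  by move=> x /=; rewrite scaler0 addr0.
have -> : 0 = ext_class c1 by rewrite -(ext_classP c0 c0) scaleN1r addNr.
have E x : z x - (-1 *: 0 + 0) = z x by rewrite scaler0 addr0 subr0.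
by rewrite ext_class_eq; split=> c; [exact: (eq_cobound E c) | exact: (eq_cobound (fsym E) c)].
Qed.

(** Pulling a cocycle of the standard resolution back to [P], and then back again
    along [F], changes it only by a coboundary, since the composite of the two
    chain maps lifts the identity. *)
Lemma ext_class_resolution N (P : resolution N) (F : chain_lift (std_resolution N) P idfun) M i
    (h : Ext i N M) :
  exists (z : {linear P i -> M}) (zc : cocycle z), h = ext_class (cocycle_comp F zc).
Proof.
have [z [zc ->]] := ext_class_surj h.
have G := some_chain_lift P (std_resolution N) idfun.
exists (z \o G i : {linear _ -> _}), (cocycle_comp G zc).
pose I : chain_lift (std_resolution N) (std_resolution N) idfun :=
  @ChainLift _ _ _ _ _ idfun (fun n => idfun) (fun=> erefl) (fun _ _ => erefl).
apply/ext_class_eq.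
exact: (chain_lift_homotopy (comp_lift F G) I (fun=> erefl) zc).
Qed.

End ExtResolution.

(** * Resolutions of cyclic modules by matrices *)

Section MatrixAction.
Variables (R : comPzRingType) (M : lmodType R).

(** In coordinates, this is the map [Hom(R^n, M) -> Hom(R^m, M)] dual to the
    action of [D] on row vectors. *)
Definition mxact m n (D : 'M[R]_(m, n)) (x : 'I_n -> M) : 'I_m -> M :=
  fun j => \sum_l D j l *: x l.

Lemma row_lift_mxact m n (D : 'M[R]_(m, n)) (x : 'I_n -> M) v :
  row_lift (mxact D x) v = row_lift x (v *m D).
Proof.
rewrite /row_lift /mxact; under eq_bigr do rewrite scaler_sumr.
rewrite exchange_big /=; apply: eq_bigr => l _.
by rewrite mxE scaler_suml; apply: eq_bigr => j _; rewrite scalerA.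
Qed.

Lemma mxactZ m n (D : 'M[R]_(m, n)) (x : 'I_n -> M) r j :
  mxact D (fun l => r *: x l) j = r *: mxact D x j.
Proof. by rewrite /mxact scaler_sumr; apply: eq_bigr => l _; rewrite scaler_swap. Qed.

End MatrixAction.

Section MatrixResolution.
Variables (R : comPzRingType).
Implicit Types (J : ideal R) (M : lmodType R).

(** A resolution of [R/J] by free modules of finite rank, in coordinates. The
    augmentation is given by lifts to [R] of its values, so that the record
    involves only elements of [R], which can be mapped to another ring. *)
Record mresolution J := MResolution {
  mdim : nat -> nat;
  mdiff : forall i, 'M[R]_(mdim i.+1, mdim i);
  maug : 'cV[R]_(mdim 0);
  maug_surj : exists v : 'rV_(mdim 0), (1 - (v *m maug) 0 0 : R^o) \in J;
  maug_exact : forall v : 'rV_(mdim 0),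
    ((v *m maug) 0 0 : R^o) \in J <-> exists w : 'rV_(mdim 1), v = w *m mdiff 0;
  mdiff_exact : forall i (v : 'rV_(mdim i.+1)),
    v *m mdiff i = 0 <-> exists w : 'rV_(mdim i.+2), v = w *m mdiff i.+1
}.

Section Coordinates.
Variables (J : ideal R) (P : mresolution J).

Definition maug_map : {linear 'rV[R]_(mdim P 0) -> quotmod J} :=
  row_lift (fun l => qproj J (maug P l 0)).

Lemma maug_mapE v : maug_map v = qproj J ((v *m maug P) 0 0).
Proof. by rewrite mxE linear_sum; apply: eq_bigr => l _; rewrite -linearZ. Qed.

Lemma qproj_eq0 (x : R^o) : qproj J x = 0 <-> x \in J.
Proof.
by rewrite -(linear0 (qproj J)); split=> [/eqP|xJ]; last apply/eqP; rewrite qproj_eq subr0.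
Qed.

Lemma maug_map_surj y : exists x, y = maug_map x.
Proof.
have [v vP] := maug_surj P; have [x ->] := qproj_surj y.
exists ((x : R) *: v); rewrite linearZ /= maug_mapE -linearZ.
apply/eqP; rewrite qproj_eq.
have -> : x - (x : R) *: ((v *m maug P) 0 0 : R^o) = (x : R) *: (1 - (v *m maug P) 0 0 : R^o).
  by rewrite scalerBr; congr (_ - _); rewrite -[RHS]/((x : R) * 1) mulr1.
exact: rpredZ.
Qed.

Lemma maug_map_exact x : maug_map x = 0 <-> exists y, x = mulmxr (mdiff P 0) y.
Proof. by rewrite maug_mapE qproj_eq0; exact: maug_exact. Qed.

Definition row_resolution : resolution (quotmod J) :=
  @Resolution R (quotmod J) (fun i => 'rV[R]_(mdim P i))
    (fun i => mulmxr (mdiff P i) : {linear _ -> _}) maug_map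
    maug_map_surj maug_map_exact (@mdiff_exact _ P)
    (fun i => @row_projective R (mdim P i)).

Variable M : lmodType R.

Definition mcocycle i (x : 'I_(mdim P i) -> M) : Prop := forall j, mxact (mdiff P i) x j = 0.

Definition mcobound i : ('I_(mdim P i) -> M) -> Prop :=
  match i with
  | 0 => fun x => forall l, x l = 0
  | j.+1 => fun x => exists y, forall l, x l = mxact (mdiff P j) y l
  end.

Lemma row_lift0 n (x : 'I_n -> M) : (forall l, x l = 0) -> forall v, row_lift x v = 0.
Proof. by move=> x0 v; rewrite /row_lift big1 // => l _; rewrite x0 scaler0. Qed.

Lemma mcocycleP i (x : 'I_(mdim P i) -> M) :
  @cocycle _ _ row_resolution M i (row_lift x) <-> mcocycle x.
Proof.
split=> xc => [j|v].
  have : row_lift x (delta_mx 0 j *m mdiff P i) = 0 := xc (delta_mx 0 j).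
  by rewrite -row_lift_mxact row_lift_delta.
by rewrite -[LHS]/(row_lift x (v *m mdiff P i)) -row_lift_mxact row_lift0.
Qed.

Lemma mcoboundP i (x : 'I_(mdim P i) -> M) :
  @cobound _ _ row_resolution M i (row_lift x) <-> mcobound x.
Proof.
case: i x => [|i] x /=; split.
- by move=> x0 l; rewrite -(row_lift_delta x l) x0.
- exact: row_lift0.
- move=> [w wE]; exists (fun l => w (delta_mx 0 l)) => l.
  rewrite -(row_lift_delta x l) wE (row_liftE w).
  by rewrite -[LHS]/(row_lift _ (delta_mx 0 l *m mdiff P i)) -row_lift_mxact row_lift_delta.
- move=> [y xy]; exists (row_lift y) => v.
  rewrite -[RHS]/(row_lift y (v *m mdiff P i)) -row_lift_mxact.
  by apply: eq_bigr => l _; rewrite xy.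
Qed.

End Coordinates.

Section Lift.
Variables (J J' : ideal R) (sub : forall x, x \in J -> idfun x \in J').
Variables (P : mresolution J) (Q : mresolution J').

Record mlift := MLift {
  mmap :> forall i, 'M[R]_(mdim P i, mdim Q i);
  mmap_aug : forall l, ((mmap 0 *m maug Q) l 0 - maug P l 0 : R^o) \in J';
  mmap_diff : forall i, mmap i.+1 *m mdiff Q i = mdiff P i *m mmap i
}.

Definition row_chain_lift (T : mlift) :
  chain_lift (row_resolution P) (row_resolution Q) (quotmap sub).
Proof.
exists (fun i => mulmxr (T i) : {linear 'rV[R]_(mdim P i) -> 'rV[R]_(mdim Q i)}).
- move=> v; rewrite -[raug (row_resolution P) v]/(maug_map P v) [LHS]maug_mapE maug_mapE.
  rewrite [RHS]quotmapE.
  apply/eqP; rewrite qproj_eq /= -mulmxA.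
  have -> : ((v *m (T 0 *m maug Q)) 0 0 - (v *m maug P) 0 0 : R^o) =
     (v *m (T 0 *m maug Q - maug P)) 0 0 by rewrite mulmxBr !mxE.
  rewrite mxE rpred_sum // => l _.
  have -> : (T 0 *m maug Q - maug P) l 0 = (T 0 *m maug Q) l 0 - maug P l 0 by rewrite !mxE.
  exact: (rpredZ (v 0 l) (mmap_aug T l)).
- by move=> i v; rewrite /= -!mulmxA mmap_diff.
Defined.

Lemma some_mlift : mlift.
Proof.
have F := some_chain_lift (row_resolution P) (row_resolution Q) (quotmap sub).
pose T i := lin1_mx (F i : {linear 'rV[R]_(mdim P i) -> 'rV[R]_(mdim Q i)}).
have TE i (v : 'rV_(mdim P i)) : v *m T i = F i v by rewrite mul_rV_lin1.
suff aT l : ((T 0 *m maug Q) l 0 - maug P l 0 : R^o) \in J'.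
  suff dT i : T i.+1 *m mdiff Q i = mdiff P i *m T i by exact: (MLift aT dT).
  apply/row_matrixP => j; rewrite !rowE !mulmxA !TE.
  exact: (clift_diff F).
have := clift_aug F (delta_mx 0 l); rewrite -TE.
rewrite -[raug (row_resolution P) _]/(maug_map P _) [LHS]maug_mapE maug_mapE.
rewrite [RHS]quotmapE.
by move/eqP; rewrite qproj_eq -mulmxA -!rowE !mxE.
Qed.

End Lift.
End MatrixResolution.

Section NoetherianResolution.
Variable R : comPzRingType.
Hypothesis noethR : noetherian R.

Lemma fg_row n : finitely_generated 'rV[R]_n.
Proof.
exists [seq delta_mx 0 l | l <- enum 'I_n] => v; rewrite [v]row_sum_delta.
rewrite rpred_sum // => l _; rewrite rpredZ //; apply: mem_mod_span.
by apply/mapP; exists l; rewrite ?mem_enum.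
Qed.

Lemma fg_row_space n (K : {pred 'rV[R]_n}) : submod_closed K ->
  exists m (D : 'M[R]_(m, n)), forall v, v \in K <-> exists w, v = w *m D.
Proof.
move=> Kcl; have [s sK Ks] := fg_noeth_mod noethR (fg_row n) Kcl.
pose D := \matrix_(i < size s) s`_i; exists (size s), D => v.
have [K0 KP] := Kcl.
split=> [/Ks vs|[w ->]].
  pose Z : {pred 'rV[R]_n} := fun v => `[< exists w : 'rV_(size s), v = w *m D >].
  suff /(_ v vs)/asboolP : {subset mod_span [in s] <= Z} by [].
  apply: mod_span_min => [|u us].
    split=> [|a _ _ /asboolP[x ->] /asboolP[y ->]]; apply/asboolP.
      by exists 0; rewrite mul0mx.
    by exists (a *: x + y); rewrite mulmxDl scalemxAl.
  have us' : (index u s < size s)%N by rewrite index_mem.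
  apply/asboolP; exists (delta_mx 0 (Ordinal us')).
  by rewrite -rowE rowK nth_index.
rewrite mulmx_sum_row; elim/big_ind: _ => // [x y xK yK|l _].
  by rewrite -[x]scale1r KP.
by rewrite -[_ *: _]addr0 KP // rowK sK // mem_nth.
Qed.

(** Start with the free module of rank 1 and its submodule [J]; at each step, the
    rows of the next matrix generate the current submodule, and the next
    submodule is the kernel of that matrix. *)
Lemma some_mresolution (J : ideal R) : mresolution J.
Proof.
pose state := {n : nat & {K : {pred 'rV[R]_n} | submod_closed K}}.
have gen : forall s : state, exists t : {m : nat & 'M[R]_(m, projT1 s)},
    forall v, v \in sval (projT2 s) <-> exists w, v = w *m projT2 t.
  move=> [n [K Kcl]] /=; have [m [D KD]] := fg_row_space Kcl.
  by exists (existT _ m D).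
pose g s := sval (cid (gen s)).
have gP s v : v \in sval (projT2 s) <-> exists w, v = w *m projT2 (g s) := svalP (cid (gen s)) v.
have ker_cl m n (D : 'M[R]_(m, n)) : submod_closed (fun v : 'rV_m => v *m D == 0).
  split=> [|a x y]; first by rewrite unfold_in mul0mx.
  by rewrite !unfold_in mulmxDl -scalemxAl => /eqP-> /eqP->; rewrite scaler0 addr0.
pose KJ : {pred 'rV[R]_1} := fun v => (v 0 0 : R^o) \in J.
have KJE v : (v \in KJ) = ((v 0 0 : R^o) \in J) by [].
have J_cl : submod_closed KJ.
  split=> [|a x y]; rewrite !KJE !mxE; first exact: rpred0.
  by move=> xJ yJ; exact: (rpredD (rpredZ a xJ) yJ).
pose next (s : state) : state :=
  existT _ (projT1 (g s)) (exist _ _ (ker_cl _ _ (projT2 (g s)))).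
pose st i : state := iter i next (existT _ 1 (exist _ _ J_cl)).
pose D i : 'M[R]_(projT1 (st i.+1), projT1 (st i)) := projT2 (g (st i)).
have e1 : exists v : 'rV[R]_1, (1 - (v *m (1%:M : 'cV[R]_1)) 0 0 : R^o) \in J.
  by exists 1%:M; rewrite mulmx1 mxE eqxx subrr rpred0.
apply: (@MResolution R J (fun i => projT1 (st i)) D (1%:M : 'cV[R]_1) e1) => [v|i v].
  by rewrite mulmx1; exact: (gP (st 0) v).
split=> [v0|]; first by apply/(gP (st i.+1) v); apply/eqP.
by move/(gP (st i.+1) v)/eqP.
Qed.

Lemma fg_ffun n (M : lmodType R) : finitely_generated M -> finitely_generated {ffun 'I_n -> M}.
Proof.
move=> [s sM].
pose d l (x : M) : {ffun 'I_n -> M} := [ffun k => if k == l then x else 0].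
have dl l : linear (d l).
  move=> a x y; apply/ffunP => k; rewrite !ffunE.
  by case: ifP => //; rewrite scaler0 addr0.
exists (flatten [seq map (d l) s | l <- enum 'I_n]) => f.
have -> : f = \sum_l d l (f l).
  apply/ffunP => k; rewrite sum_ffunE (bigD1 k) //= ffunE eqxx big1 ?addr0 // => l lk.
  by rewrite ffunE eq_sym (negPf lk).
rewrite rpred_sum // => l _; apply: mod_spanS (mod_span_map (dl l) (sM (f l))).
move=> x xs; apply/flattenP; exists (map (d l) s) => //.
by apply/mapP; exists l; rewrite ?mem_enum.
Qed.

(** A finite resolution presents [Ext] as a quotient of a submodule of [M^n]. *)
Lemma fg_Ext (J : ideal R) (M : lmodType R) i :
  finitely_generated M -> finitely_generated (Ext i (quotmod J) M).
Proof.
move=> fgM; have P := some_mresolution J.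
have F := some_chain_lift (std_resolution (quotmod J)) (row_resolution P) idfun.
pose K : {pred {ffun 'I_(mdim P i) -> M}} := fun x => `[< mcocycle x >].
have Kcl : submod_closed K.
  split=> [|a x y /asboolP xc /asboolP yc]; apply/asboolP => j.
    by rewrite /mxact big1 // => l _; rewrite ffunE scaler0.
  have -> : mxact (mdiff P i) (a *: x + y) j = a *: mxact (mdiff P i) x j + mxact (mdiff P i) y j.
    rewrite /mxact scaler_sumr -big_split; apply: eq_bigr => l _.
    by rewrite !ffunE scalerDr scaler_swap.
  by rewrite xc yc scaler0 addr0.
pose Ks : submodClosed {ffun 'I_(mdim P i) -> M} := HB.pack K
  (GRing.isSubmodClosed.Build R {ffun 'I_(mdim P i) -> M} K Kcl).
have Kc (x : submod Ks) : @cocycle _ _ (row_resolution P) M i (row_lift (val x)).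
  by apply/mcocycleP; have /asboolP := valP x.
pose phi x : Ext i (quotmod J) M := ext_class (cocycle_comp F (Kc x)).
have phil : linear phi.
  move=> a x y; rewrite /phi (ext_classP _ _ (cocycleZD a (cocycle_comp F (Kc x)) (cocycle_comp F (Kc y)))).
  apply: eq_ext_class => v /=.
  rewrite /row_lift scaler_sumr -big_split; apply: eq_bigr => l _.
  by rewrite !ffunE scalerDr scaler_swap.
have fgK : fg_sub (@fullmod R (submod Ks)).
  by apply/fg_fullmod/fg_submod; apply: fg_noeth_mod => //; exact: fg_ffun.
apply/fg_fullmod; apply: eq_fg_sub (fg_image phil fgK) => h.
apply/asboolP; have [z [zc ->]] := ext_class_resolution F h.
have zK : [ffun l => z (delta_mx 0 l)] \in Ks.
  apply/asboolP; apply/mcocycleP => v; rewrite -(zc v) (row_liftE z).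
  by apply: eq_bigr => l _; rewrite ffunE.
exists (in_submod zK) => //; apply: eq_ext_class => v /=.
by rewrite (row_liftE z); apply: eq_bigr => l _; rewrite ffunE.
Qed.

(** Evaluation of cocycles at the basis element [e] over [1] identifies
    [Ext^0(R/J, X)] with [torsion_by J X]. *)
Lemma fg_torsion_by (J : ideal R) (X : lmodType R) :
  finitely_generated (Ext 0 (quotmod J) X) -> fg_sub (torsion_by J X).
Proof.
move=> [hs hsE].
pose N : lmodType R := quotmod J; pose F := std_resolution N.
pose e : F 0 := fbasis R (qproj J 1).
have augE : raug F e = qproj J 1 by exact: free_lift_basis.
have eT (z : {linear F 0 -> X}) : cocycle z -> z e \in torsion_by J X.
  move=> zc; apply/asboolP => r rJ; rewrite -linearZ.
  have [|y ->] := iffLR (raug_exact (r *: e : F 0)); last exact: zc.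
  have -> : raug F (r *: e) = r *: raug F e by exact: linearZ.
  rewrite augE -linearZ.
  by apply/qproj_eq0; rewrite -[_ *: _]/(r * 1) mulr1.
have /choice[w wP] : forall h : Ext 0 N X, exists x, exists (z : {linear F 0 -> X}) (zc : cocycle z),
    h = ext_class zc /\ x = z e.
  by move=> h; have [z [zc hz]] := ext_class_surj h; exists (z e), z, zc.
exists (map w hs) => [_ /mapP[h _ ->]|x /asboolP xT].
  by have [z [zc [_ ->]]] := wP h; exact: eT.
pose Z : {pred Ext 0 N X} := fun h => `[< exists (z : {linear F 0 -> X}) (zc : cocycle z),
  h = ext_class zc /\ z e \in mod_span [in map w hs] >].
have hZ : {subset mod_span [in hs] <= Z}.
  apply: mod_span_min => [|h hhs].
    split=> [|a h h' /asboolP[z [zc [-> ze]]] /asboolP[z' [zc' [-> ze']]]]; apply/asboolP.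
      have c : cocycle (\0 : {linear F 0 -> X}) by [].
      exists \0, c; split; last exact: rpred0.
      by apply/esym/ext_class_eq0.
    exists (a \*: z \+ z'), (cocycleZD a zc zc'); split; first exact: ext_classP.
    exact: (rpredD (rpredZ _ ze) ze').
  have [z [zc [hz we]]] := wP h; apply/asboolP; exists z, zc; split=> //.
  by rewrite -we; apply: mem_mod_span; apply: map_f.
have xl : linear (fun r : R^o => (r : R) *: x).
  by move=> a r q; rewrite scalerDl -scalerA.
have xJ (r : R^o) : r \in J -> (r : R) *: x = 0 by exact: xT.
pose y (q : N) : X := (repr q : R) *: x.
have yE (r : R) : y (qproj J r) = r *: x.
  apply/eqP; rewrite -subr_eq0 -scalerBl; apply/eqP/xJ.
  by rewrite -qproj_eq; apply/eqP; rewrite [LHS]reprK.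
have yl : linear y.
  move=> a q q'; have [r ->] := qproj_surj q; have [r' ->] := qproj_surj q'.
  by rewrite -linearP !yE; exact: xl.
pose Y : {linear N -> X} := HB.pack y (GRing.isLinear.Build R N X *:%R y yl).
have zc : cocycle (Y \o raug F : {linear F 0 -> X}).
  move=> v; rewrite -[LHS]/(Y (raug F (rdiff F 0 v))).
  have -> : raug F (rdiff F 0 v) = 0 by apply/raug_exact; exists v.
  exact: linear0.
have /hZ/asboolP[z' [zc' [/ext_class_eq E ze']]] := hsE (ext_class zc).
have /eqP := E e; rewrite subr_eq0 => /eqP xe.
have {}xe : Y (raug F e) = z' e := xe.
move: ze'; rewrite -xe augE.
by rewrite -[Y _]/(y (qproj J 1)) yE scale1r.
Qed.

End NoetherianResolution.

(** * Elements of local cohomology as cocycles of finite resolutions *)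

Section DirLim.
Variables (R : comPzRingType) (E : nat -> lmodType R) (t : forall n, {linear E n -> E n.+1}).

Lemma dinjE n (x : E n) : val (dinj x) n = x.
Proof. exact: dfwith_in. Qed.

Lemma dinj_out n (x : E n) m : n != m -> val (dinj x) m = 0.
Proof. by move=> nm; rewrite /= dfwith_out. Qed.

Lemma dinj_linear n : linear (@dinj R nat E n).
Proof.
move=> a x y; apply: val_inj; apply: functional_extensionality_dep => m.
rewrite [RHS]/(a *: val (dinj x) m + val (dinj y) m).
have [<-|nm] := eqVneq n m; first by rewrite !dinjE.
by rewrite [LHS]dinj_out // (dinj_out x) // (dinj_out y) // scaler0; exact: esym (addr0 _).
Qed.

Definition dirlim_incl n (x : E n) : dirlim t := qproj _ (dinj x).

Lemma dirlim_incl_linear n : linear (@dirlim_incl n).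
Proof. by move=> a x y; rewrite /dirlim_incl dinj_linear linearP. Qed.

Lemma dirlim_incl_step n (x : E n) : dirlim_incl x = dirlim_incl (t n x).
Proof.
apply/eqP; rewrite qproj_eq; apply: mem_mod_span; apply/asboolP.
by exists n, x.
Qed.

(** The sum in [E m] of the images of the entries of [y] of index at most [m].
    For large [m] it kills the relations of the direct limit, so it detects which
    elements vanish in the limit. *)
Fixpoint dpush m (y : dsum E) : E m :=
  match m return E m with
  | 0 => val y 0
  | k.+1 => t k (dpush k y) + val y k.+1
  end.

Lemma dpush_linear m : linear (dpush m).
Proof.
elim: m => [|m IHm] a x y //=.
rewrite IHm linearP scalerDr -!addrA; congr (_ + _).
by rewrite addrCA.
Qed.

Lemma dpush_lt m n (x : E n) : (m < n)%N -> dpush m (dinj x) = 0.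
Proof.
elim: m => [|m IHm] mn; first by rewrite /dpush dinj_out // neq_ltn mn orbT.
by rewrite /dpush -/dpush IHm 1?ltnW // linear0 add0r dinj_out // neq_ltn mn orbT.
Qed.

Lemma dpush_eq n (x : E n) : dpush n (dinj x) = x.
Proof.
case: n x => [|n] x; first exact: dinjE.
by rewrite /dpush -/dpush dpush_lt // linear0 add0r dinjE.
Qed.

Lemma dpush_step m n (x : E n) : (n <= m)%N ->
  dpush m.+1 (dinj x) = t m (dpush m (dinj x)).
Proof. by move=> nm; rewrite {1}/dpush -/dpush dinj_out ?addr0 // neq_ltn ltnS nm. Qed.

Lemma dirlim_incl_eq0 n (x : E n) :
  dirlim_incl x = 0 <-> exists2 m, (n <= m)%N & dpush m (dinj x) = 0.
Proof.
split=> [/eqP|[m]].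
  pose Z : {pred dsum E} := fun y =>
    `[< exists k, forall m, (k <= m)%N -> dpush m y = 0 >].
  have relZ : {subset mod_span (dirlim_rel t) <= Z}.
    have push0 m : dpush m 0 = 0 := linear_map0 (dpush_linear m).
    apply: mod_span_min => [|_ /asboolP[k [y ->]]].
      split=> [|a y z /asboolP[k ky] /asboolP[l lz]]; apply/asboolP; first by exists 0.
      exists (maxn k l) => m; rewrite geq_max => /andP[km lm].
      by rewrite dpush_linear ky // lz // scaler0 addr0.
    apply/asboolP; exists k.+1; elim=> // m IHm; rewrite leq_eqVlt => /orP[/eqP[<-]|km].
      rewrite -[_ - _]addrC -scaleN1r dpush_linear dpush_eq dpush_step //.
      by rewrite dpush_eq scaleN1r addNr.
    move: (IHm km); rewrite -![_ - _]addrC -!scaleN1r !dpush_linear.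
    rewrite (dpush_step (n := k.+1)) // (dpush_step (n := k)) 1?ltnW //.
    by rewrite -linearP => ->; rewrite linear0.
  rewrite -(linear0 (qproj (mod_span (dirlim_rel t)))) qproj_eq subr0 => /relZ/asboolP[k kx].
  by exists (maxn n k); rewrite ?leq_maxl // kx // leq_maxr.
move=> nm; suff -> : dirlim_incl x = dirlim_incl (dpush m (dinj x)).
  by move=> ->; exact: linear_map0 (@dirlim_incl_linear m).
elim: m nm => [|m IHm]; first by rewrite leqn0 => /eqP n0; subst n; rewrite dpush_eq.
rewrite leq_eqVlt => /orP[/eqP nm|nm]; first by subst n; rewrite dpush_eq.
by rewrite IHm // dirlim_incl_step dpush_step.
Qed.

Lemma dirlim_incl_surj (h : dirlim t) : exists n (x : E n), h = dirlim_incl x.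
Proof.
have lift m n (x : E n) : (n <= m)%N -> exists y : E m, dirlim_incl x = dirlim_incl y.
  elim: m => [|m IHm]; first by rewrite leqn0 => /eqP n0; subst n; exists x.
  rewrite leq_eqVlt => /orP[/eqP nm|nm]; first by subst n; exists x.
  by have [//|y ->] := IHm _; exists (t m y); exact: dirlim_incl_step.
have [y ->] := qproj_surj h.
have [N yN] : exists N, forall m, (N <= m)%N -> val y m = 0.
  have /asboolP/finite_fsetP[X XE] := valP y.
  exists (\max_(k <- (finmap.enum_fset X : seq nat)) k).+1 => m Xm; apply/eqP; apply: contraLR Xm => ym.
  have : [set k : nat | val y k != 0]%classic m by [].
  by rewrite XE -ltnNge ltnS => /= mX; exact: (@leq_bigmax_seq _ (finmap.enum_fset X : seq nat) xpredT id m mX isT).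
have -> : y = \sum_(k < N) dinj (val y k).
  apply: val_inj; apply: functional_extensionality_dep => m.
  have vsum (s : seq 'I_N) : val (\sum_(k <- s) dinj (val y k)) m = \sum_(k <- s) val (dinj (val y k)) m.
    by elim: s => [|k s IHs]; rewrite ?big_nil // !big_cons -IHs.
  rewrite vsum; have [Nm|mN] := leqP N m.
    rewrite yN // big1_seq // => k _; rewrite dinj_out // neq_ltn.
    by rewrite (leq_trans (ltn_ord k) Nm).
  rewrite (bigD1 (Ordinal mN)) // [X in _ = X + _](dinjE (val y m)) big1 => [|k km].
    by rewrite addr0.
  by rewrite dinj_out.
rewrite linear_sum /=; elim/big_ind: _ => [|a b [n [x ->]] [m [z ->]]|k _].
- by exists 0, 0; rewrite (linear_map0 (@dirlim_incl_linear 0)).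
- have [x' ->] := lift (maxn n m) n x (leq_maxl _ _).
  have [z' ->] := lift (maxn n m) m z (leq_maxr _ _).
  by exists (maxn n m), (x' + z'); rewrite -{2}[x']scale1r dirlim_incl_linear scale1r.
- by exists k, (val y k).
Qed.

End DirLim.

Section LocalCohomologyCocycles.
Variables (R : comPzRingType) (a : ideal R) (M : lmodType R) (i : nat).

Lemma cobound_cohomologous N (P : resolution N) (u w : {linear P i -> M}) :
  cobound (fun x => u x - w x) -> cobound u <-> cobound w.
Proof.
move: u w; case: i => [|j] u w /=.
  move=> uw; split=> [u0|w0] x; have /eqP := uw x; rewrite subr_eq0 => /eqP.
    by rewrite u0.
  by rewrite w0.
move=> [h uw]; split=> [[v uv]|[v wv]].
  exists (v \- h : {linear _ -> _}) => x /=; rewrite -uv -uw opprB addrC.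
  by rewrite subrK.
by exists (h \+ v : {linear _ -> _}) => x /=; rewrite -uw -wv subrK.
Qed.

(** [F'] is homotopic to [F] preceded by a comparison map from [P'] to [P], since
    both lift [f]. *)
Lemma cobound_transfer N N' (P P' : resolution N) (Q : resolution N') (f : {linear N -> N'})
    (F : chain_lift P Q f) (F' : chain_lift P' Q f) (z : {linear Q i -> M}) :
  cocycle z -> cobound (z \o F i) -> cobound (z \o F' i).
Proof.
move=> zc zF; have G := some_chain_lift P' P idfun.
apply/(cobound_cohomologous (u := z \o F' i) (w := (z \o F i) \o G i)).
  exact: (chain_lift_homotopy (comp_lift G F) F' (fun=> erefl) zc).
exact: (cobound_comp G zF).
Qed.

Local Notation pow n := (ideal_exp a n.+1).

Lemma ideal_expS_le m n : (m <= n)%N -> forall x, x \in pow n -> idfun x \in pow m.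
Proof. by move=> mn x; apply: ideal_exp_le. Qed.

Variable P : forall n, mresolution (pow n).
Variable T : forall n m, (n <= m)%N -> mlift (P m) (P n).

Local Notation F n := (std_resolution (quotmod (pow n))).
Local Notation Q n := (row_resolution (P n)).

Definition ev_cobound n (x : 'I_(mdim (P n) i) -> M) : Prop :=
  exists m (nm : (n <= m)%N), mcobound (P := P m) (mxact (T nm i) x).

(** A transition map of the direct system composes the chain map with a lift of
    [R/a^m.+2 -> R/a^m.+1]; the class only depends on the map that is lifted. *)
Lemma dpush_ext_class n m (nm : (n <= m)%N) (z : {linear Q n i -> M}) (zc : cocycle z)
    (G : chain_lift (F n) (Q n) idfun) (H : chain_lift (F m) (Q n) (quotmap (ideal_expS_le nm))) :
  dpush (fun n => Ext_map (power_proj a n.+1) M i) m (dinj (ext_class (cocycle_comp G zc)))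
    = ext_class (cocycle_comp H zc).
Proof.
elim: m nm H => [|m IHm] nm H.
  have n0 : n = 0%N by apply/eqP; rewrite -leqn0.
  subst n; rewrite dpush_eq.
  apply: ext_class_lift => x; have [y ->] := qproj_surj x.
  by rewrite [RHS]quotmapE.
have : (n == m.+1) || (n < m.+1)%N by rewrite -leq_eqVlt.
move=> /orP[/eqP nm'|nm'].
  subst n; rewrite dpush_eq; apply: ext_class_lift => x; have [y ->] := qproj_surj x.
  by rewrite [RHS]quotmapE.
rewrite ltnS in nm'.
have H' := some_chain_lift (F m) (Q n) (quotmap (ideal_expS_le nm')).
rewrite dpush_step // (IHm nm' H') (ext_class_map _ (cocycle_comp (std_lift _) (cocycle_comp H' zc))).
pose H1 := comp_lift (std_lift (power_proj a m.+1)) H'.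
transitivity (ext_class (cocycle_comp H1 zc)); first exact: eq_ext_class.
apply: ext_class_lift => x.
by have [y ->] := qproj_surj x; rewrite /= !quotmapE.
Qed.

Lemma loccoh_class_eq0 n (x : 'I_(mdim (P n) i) -> M) (xc : cocycle (row_lift x : {linear Q n i -> M}))
    (G : chain_lift (F n) (Q n) idfun) :
  dirlim_incl (fun n => Ext_map (power_proj a n.+1) M i) (ext_class (cocycle_comp G xc)) = 0
    <-> ev_cobound x.
Proof.
rewrite dirlim_incl_eq0; split=> [[m nm]|[m [nm]]].
  have H := some_chain_lift (F m) (Q n) (quotmap (ideal_expS_le nm)).
  rewrite (dpush_ext_class xc G H) => /ext_class_eq0 xH; exists m, nm.
  apply/mcoboundP.
  have := cobound_transfer (row_chain_lift (ideal_expS_le nm) (T nm)) xc xH.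
  by apply: eq_cobound => v; rewrite [RHS]row_lift_mxact.
move=> /mcoboundP xT; exists m => //.
have H := some_chain_lift (F m) (Q n) (quotmap (ideal_expS_le nm)).
rewrite (dpush_ext_class xc G H); apply/ext_class_eq0.
apply: (cobound_transfer (F := row_chain_lift (ideal_expS_le nm) (T nm)) H xc).
by apply: eq_cobound xT => v; rewrite [LHS]row_lift_mxact.
Qed.

(** An element of the direct limit is represented by a cocycle of one of the
    finite resolutions, and it vanishes iff this cocycle becomes a coboundary
    further on. Only annihilators are recorded: they are all that has to be
    compared with the localisation, and they can be read off without relating
    modules over different rings by a map. *)
Lemma loccoh_annihilators :
  (forall h : loccoh a i M, exists n (x : 'I_(mdim (P n) i) -> M), mcocycle x /\
     forall r : R, r *: h = 0 <-> ev_cobound (fun l => r *: x l)) /\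
  (forall n (x : 'I_(mdim (P n) i) -> M), mcocycle x -> exists h : loccoh a i M,
     forall r : R, r *: h = 0 <-> ev_cobound (fun l => r *: x l)).
Proof.
have main n (x : 'I_(mdim (P n) i) -> M) (xc : cocycle (row_lift x : {linear Q n i -> M}))
    (G : chain_lift (F n) (Q n) idfun) (r : R) :
  r *: (dirlim_incl (fun n => Ext_map (power_proj a n.+1) M i) (ext_class (cocycle_comp G xc)))
    = 0 <-> ev_cobound (fun l => r *: x l).
  have xr : cocycle (row_lift (fun l => r *: x l) : {linear Q n i -> M}).
    apply/mcocycleP => j; rewrite mxactZ.
    by move/mcocycleP: xc => ->; rewrite scaler0.
  have c0 : cocycle (\0 : {linear F n i -> M}) by [].
  have e0 : ext_class c0 = 0 by apply/ext_class_eq0; case: (i) => //= j; exists \0.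
  rewrite -(loccoh_class_eq0 xr G).
  have -> : ext_class (cocycle_comp G xr) = r *: ext_class (cocycle_comp G xc).
    rewrite -[RHS]addr0 -e0 (ext_classP _ _ (cocycleZD r (cocycle_comp G xc) c0)).
    apply: eq_ext_class => v /=.
    by rewrite addr0 /row_lift scaler_sumr; apply: eq_bigr => l _; rewrite scaler_swap.
  have lin := @dirlim_incl_linear _ _ (fun n => Ext_map (power_proj a n.+1) M i) n.
  by rewrite -[r *: ext_class _]addr0 lin (linear_map0 lin) addr0.
split=> [h|n x xc]; last first.
  have G := some_chain_lift (F n) (Q n) idfun.
  have xc' : cocycle (row_lift x : {linear Q n i -> M}) by apply/mcocycleP.
  by eexists; exact: (main n x xc' G).
have [n [e ->]] := dirlim_incl_surj h.
have G := some_chain_lift (F n) (Q n) idfun.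
have [z [zc ->]] := ext_class_resolution G e.
pose x l := z (delta_mx 0 l).
have xc : cocycle (row_lift x : {linear Q n i -> M}) by move=> v; rewrite -(zc v) (row_liftE z).
exists n, x; split=> [|r]; first by apply/mcocycleP.
rewrite -(main n x xc G); suff -> : ext_class (cocycle_comp G zc) = ext_class (cocycle_comp G xc) by [].
by apply: eq_ext_class => v /=; rewrite (row_liftE z).
Qed.

End LocalCohomologyCocycles.

(** * Localisation *)

Section Localize.
Variables (R : comPzRingType) (p : prime_ideal R).
Local Notation S := (locring p).
#[local] Arguments dval : simpl never.

Definition loc_of (r : R) : S := loc_frac (r : R^o) (denom1 p).

Section Fractions.
Variable V : lmodType R.
Implicit Types (x y : V) (s t u : denom p).

Lemma frac_add x y s : loc_frac x s + loc_frac y s = loc_frac (x + y) s.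
Proof. by rewrite fracD -scalerDr; apply: frac_eq; rewrite dvalM scalerA. Qed.

Lemma frac0 s : loc_frac (0 : V) s = 0.
Proof. by apply: frac_eq; rewrite !scaler0. Qed.

Lemma frac_sum (I : Type) (r : seq I) (x : I -> V) s :
  \sum_(k <- r) loc_frac (x k) s = loc_frac (\sum_(k <- r) x k) s.
Proof.
elim: r => [|k r IHr]; first by rewrite !big_nil frac0.
by rewrite !big_cons IHr frac_add.
Qed.

Lemma scale_frac (r : R^o) s x t :
  (loc_frac r s : S) *: loc_frac x t = loc_frac ((r : R) *: x) (denom_mul s t).
Proof. exact: loc_scaleE. Qed.

Lemma scale_loc_of (r : R) x s : loc_of r *: loc_frac x s = loc_frac (r *: x) s.
Proof. by rewrite scale_frac; apply: frac_eq; rewrite dvalM dval1 mul1r. Qed.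

Lemma frac_eq0 x s : loc_frac x s = 0 <-> exists u, dval u *: x = 0.
Proof.
rewrite -(frac0 (denom1 p)); split=> [/frac_eqP[u]|[u ux]].
  by rewrite dval1 mulr1 scaler0; exists u.
by apply/frac_eqP; exists u; rewrite dval1 mulr1 ux scaler0.
Qed.

Lemma frac_cancel u x s : loc_frac (dval u *: x) (denom_mul u s) = loc_frac x s.
Proof. by apply: frac_eq; rewrite scalerA dvalM mulrC. Qed.

(** Take the product of the denominators, one for each condition. *)
Lemma common_denom n (Q : 'I_n -> denom p -> Prop) :
    (forall l u t, Q l u -> Q l (denom_mul u t)) -> (forall l, exists u, Q l u) ->
  exists u, forall l, Q l u.
Proof.
move=> QM Qe.
suff /(_ (enum 'I_n)) [u uP] : forall r : seq 'I_n, exists u, forall l, l \in r -> Q l u.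
  by exists u => l; apply: uP; rewrite mem_enum.
have mulC u t : denom_mul u t = denom_mul t u by apply: val_inj; exact: mulrC.
elim=> [|k r [u uP]]; first by exists (denom1 p).
have [t kt] := Qe k; exists (denom_mul t u) => l; rewrite in_cons => /orP[/eqP->|lr].
  exact: QM.
by rewrite mulC; apply: QM; apply: uP.
Qed.

Lemma common_frac n (x : 'I_n -> locmod p V) :
  exists s (y : 'I_n -> V), forall l, x l = loc_frac (y l) s.
Proof.
have [l u t [y yE]|l|s sP] := @common_denom n (fun l s => exists y, x l = loc_frac y s).
- exists (dval t *: y); rewrite yE.
  by apply: frac_eq; rewrite dvalM scalerA.
- by have [y [s yE]] := frac_surj (x l); exists s, y.
by have /choice[y yE] := sP; exists s, y.
Qed.

End Fractions.

Lemma mul_frac (r q : R^o) (s t : denom p) :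
  (loc_frac r s : S) * (loc_frac q t : S) = loc_frac ((r : R) *: q) (denom_mul s t).
Proof. exact: loc_scaleE. Qed.

Fact loc_of_is_zmod : zmod_morphism loc_of.
Proof.
by move=> x y; apply/eqP; rewrite eq_sym subr_eq eq_sym /loc_of; apply/eqP; rewrite frac_add subrK.
Qed.

Fact loc_of_is_monoid : monoid_morphism loc_of.
Proof. by split=> // x y; apply/esym; rewrite /loc_of [LHS]mul_frac; apply: frac_eq; rewrite dvalM dval1 !mul1r. Qed.

HB.instance Definition _ := GRing.isZmodMorphism.Build R S loc_of loc_of_is_zmod.
HB.instance Definition _ := GRing.isMonoidMorphism.Build R S loc_of loc_of_is_monoid.

Lemma mem_loc_ideal (I : ideal R) (q : S) :
  (q : S^o) \in loc_ideal p I <-> exists2 x : R^o, x \in I & exists s, q = loc_frac x s.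
Proof.
split=> [|[x xI [s ->]]].
  pose Z : {pred S^o} := fun q => `[< exists2 x : R^o, x \in I & exists s, q = loc_frac x s >].
  suff sub : {subset loc_ideal p I <= Z} by move=> /sub/asboolP.
  apply: mod_span_min => [|_ /asboolP[x xI ->]]; last first.
    by apply/asboolP; exists x => //; exists (denom1 p).
  split=> [|c _ _ /asboolP[x xI [s ->]] /asboolP[y yI [t ->]]]; apply/asboolP.
    by exists 0; [exact: rpred0 | exists (denom1 p)].
  have [r [v ->]] := frac_surj c.
  exists (dval t *: ((r : R) *: x) + dval (denom_mul v s) *: y).
    by rewrite rpredD ?rpredZ.
  exists (denom_mul (denom_mul v s) t).
  by rewrite -fracD -mul_frac.
have -> : loc_frac x s = (loc_frac (1 : R^o) s : S) * (loc_frac x (denom1 p) : S).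
  by rewrite mul_frac scale1r; apply: frac_eq; rewrite dvalM dval1 mulr1.
apply: (rpredZ (loc_frac (1 : R^o) s : S)); apply: mem_mod_span; apply/asboolP.
by exists x.
Qed.

Lemma mem_loc_exp (I : ideal R) n (q : S) :
  (q : S^o) \in ideal_exp (loc_ideal p I) n <->
  exists2 x : R^o, x \in ideal_exp I n & exists s, q = loc_frac x s.
Proof.
elim: n q => [|n IHn] q.
  by split=> // _; have [x [s ->]] := frac_surj q; exists x => //; exists s.
split=> [|[x xI [s ->]]].
  suff sub : {subset ideal_exp (loc_ideal p I) n.+1 <= loc_ideal p (ideal_exp I n.+1)}.
    by move=> /sub/mem_loc_ideal.
  apply: mod_span_min => [|_ /asboolP[c /mem_loc_ideal[x xI [s ->]] [d dI ->]]].
    exact: mod_span_closed.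
  have [y yI [t ->]] := iffLR (IHn d) dI.
  apply/mem_loc_ideal; exists ((x : R) * (y : R)); first exact: mem_ideal_expS.
  by exists (denom_mul s t); rewrite [LHS]mul_frac.
suff : (loc_frac x s : S^o) \in ideal_exp (loc_ideal p I) n.+1 by [].
have -> : loc_frac x s = (loc_frac (1 : R^o) s : S) * loc_of x.
  by rewrite mul_frac scale1r; apply: frac_eq; rewrite dvalM dval1 mulr1.
apply: (rpredZ (loc_frac (1 : R^o) s : S)).
pose Z : {pred R^o} := fun x => `[< (loc_of x : S^o) \in ideal_exp (loc_ideal p I) n.+1 >].
suff /(_ x xI)/asboolP : {subset ideal_exp I n.+1 <= Z} by [].
apply: mod_span_min => [|_ /asboolP[y yI [z zI ->]]].
  split=> [|c y z /asboolP yZ /asboolP zZ]; apply/asboolP.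
    by rewrite rmorph0 rpred0.
  rewrite rmorphD /= -[c *: y]/((c : R) * (y : R)) rmorphM /=.
  exact: (rpredD (rpredZ (loc_of c) yZ) zZ).
apply/asboolP; rewrite -[y *: z]/((y : R) * (z : R)) rmorphM /=.
apply: mem_ideal_expS; first by apply/mem_loc_ideal; exists y => //; exists (denom1 p).
by apply/IHn; exists z => //; exists (denom1 p).
Qed.

End Localize.

Section LocalizeResolution.
Variables (R : comPzRingType) (p : prime_ideal R).
Local Notation S := (locring p).
#[local] Arguments dval : simpl never.

Definition row_frac n (v : 'rV[R]_n) (s : denom p) : 'rV[S]_n :=
  \row_l loc_frac (v 0 l : R^o) s.

Lemma row_frac_surj n (v : 'rV[S]_n) : exists w s, v = row_frac w s.
Proof.
have [s [y yE]] := @common_frac R p R^o n (fun l => v 0 l).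
by exists (\row_l (y l : R)), s; apply/rowP => l; rewrite !mxE yE.
Qed.

Lemma row_frac_mul m n (v : 'rV[R]_m) s (D : 'M[R]_(m, n)) :
  row_frac v s *m map_mx (loc_of p) D = row_frac (v *m D) s.
Proof.
apply/rowP => j; rewrite !mxE.
transitivity (\sum_k loc_frac ((v 0 k : R) *: (D k j : R^o)) s).
  apply: eq_bigr => k _; rewrite !mxE [LHS]mul_frac; apply: frac_eq.
  by rewrite dvalM dval1 mulr1.
by rewrite frac_sum.
Qed.

Lemma row_frac_cancel n (v : 'rV[R]_n) u s :
  row_frac (dval u *: v) (denom_mul u s) = row_frac v s.
Proof. by apply/rowP => l; rewrite !mxE [LHS]frac_cancel. Qed.

Lemma row_frac_eq0 n (v : 'rV[R]_n) s : row_frac v s = 0 -> exists u : denom p, dval u *: v = 0.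
Proof.
move=> v0; have [l u t|l|u uP] := @common_denom R p n (fun l u => dval u * v 0 l = 0).
- by rewrite dvalM mulrAC => ->; rewrite mul0r.
- have /rowP/(_ l) := v0; rewrite !mxE => /frac_eq0[u uv]; by exists u.
by exists u; apply/rowP => l; rewrite !mxE uP.
Qed.

Lemma row_frac0 n s : row_frac (0 : 'rV[R]_n) s = 0.
Proof. by apply/rowP => l; rewrite !mxE frac0. Qed.

Section Resolution.
Variables (J : ideal R) (J' : ideal S) (P : mresolution J).
Hypothesis JJ' : forall q : S, (q : S^o) \in J' <->
  exists2 x : R^o, x \in J & exists s, q = loc_frac x s.

Lemma loc_maug_surj : exists v : 'rV[S]_(mdim P 0),
  (1 - (v *m map_mx (loc_of p) (maug P)) 0 0 : S^o) \in J'.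
Proof.
have [v vJ] := maug_surj P; exists (map_mx (loc_of p) v).
apply/JJ'; exists (1 - (v *m maug P) 0 0 : R^o) => //; exists (denom1 p).
by rewrite -map_mxM mxE -[RHS]/(loc_of p _) rmorphB rmorph1.
Qed.

(** Exactness is transferred by writing a row vector over [R_p] with a common
    denominator: a relation in [R_p] holds over [R] after multiplication by a
    denominator, and lifts there. *)
Lemma loc_maug_exact (v : 'rV[S]_(mdim P 0)) :
  ((v *m map_mx (loc_of p) (maug P)) 0 0 : S^o) \in J' <->
  exists w, v = w *m map_mx (loc_of p) (mdiff P 0).
Proof.
have [w [s ->]] := row_frac_surj v; rewrite row_frac_mul mxE.
split=> [/JJ'[x xJ [t /frac_eqP[u wx]]]|[v']]; last first.
  have [w' [s' ->]] := row_frac_surj v'; rewrite row_frac_mul => ww'.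
  apply/JJ'; exists ((w' *m mdiff P 0 *m maug P) 0 0 : R^o).
    by apply/maug_exact; exists w'.
  exists s'; have := row_frac_mul w s (maug P); rewrite ww' row_frac_mul => /rowP/(_ 0).
  by rewrite !mxE.
have /maug_exact[w' w'E] : (((dval (denom_mul u t) *: w) *m maug P) 0 0 : R^o) \in J.
  by rewrite -scalemxAl mxE dvalM [_ * _]wx; exact: rpredZ.
exists (row_frac w' (denom_mul (denom_mul u t) s)).
by rewrite row_frac_mul -w'E row_frac_cancel.
Qed.

Lemma loc_mdiff_exact i (v : 'rV[S]_(mdim P i.+1)) :
  v *m map_mx (loc_of p) (mdiff P i) = 0 <->
  exists w, v = w *m map_mx (loc_of p) (mdiff P i.+1).
Proof.
have [w [s ->]] := row_frac_surj v; split=> [|[v' ->]].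
  rewrite row_frac_mul => /row_frac_eq0[u]; rewrite scalemxAl => /mdiff_exact[w' w'E].
  exists (row_frac w' (denom_mul u s)).
  by rewrite row_frac_mul -w'E row_frac_cancel.
have [w' [s' ->]] := row_frac_surj v'; rewrite !row_frac_mul.
have -> : w' *m mdiff P i.+1 *m mdiff P i = 0 by apply/mdiff_exact; exists w'.
exact: row_frac0.
Qed.

Definition loc_mresolution : mresolution J' :=
  MResolution loc_maug_surj loc_maug_exact loc_mdiff_exact.

End Resolution.

Section Lift.
Variables (J1 J2 : ideal R) (J1' J2' : ideal S).
Variables (P1 : mresolution J1) (P2 : mresolution J2).
Hypothesis JJ1 : forall q : S, (q : S^o) \in J1' <->
  exists2 x : R^o, x \in J1 & exists s, q = loc_frac x s.
Hypothesis JJ2 : forall q : S, (q : S^o) \in J2' <->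
  exists2 x : R^o, x \in J2 & exists s, q = loc_frac x s.

Definition loc_mlift (T : mlift P1 P2) :
  mlift (loc_mresolution P1 JJ1) (loc_mresolution P2 JJ2).
Proof.
exists (fun i => map_mx (loc_of p) (T i)) => [l|i] /=; last first.
  by rewrite -!map_mxM mmap_diff.
apply/JJ2; exists ((T 0 *m maug P2) l 0 - maug P1 l 0 : R^o); first exact: mmap_aug.
by exists (denom1 p); rewrite -map_mxM [X in X - _]mxE [X in _ - X]mxE -[RHS]/(loc_of p _) rmorphB.
Defined.

End Lift.

Section Cohomology.
Variables (M : lmodType R).

Lemma mxact_frac m n (D : 'M[R]_(m, n)) (x : 'I_n -> M) s j :
  mxact (map_mx (loc_of p) D) (fun l => loc_frac (x l) s) j = loc_frac (mxact D x j) s.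
Proof.
rewrite /mxact -frac_sum; apply: eq_bigr => l _.
by rewrite mxE scale_loc_of.
Qed.

Variables (a : ideal R) (i : nat).
Variable P : forall n, mresolution (ideal_exp a n.+1).
Variable T : forall n m, (n <= m)%N -> mlift (P m) (P n).

Let P' n := loc_mresolution (P n) (@mem_loc_exp R p a n.+1).
Let T' n m (nm : (n <= m)%N) : mlift (P' m) (P' n) := loc_mlift _ _ (T nm).

Lemma eq_mcobound (A : comPzRingType) (J : ideal A) (Q : mresolution J) (N : lmodType A) k
  (x y : 'I_(mdim Q k) -> N) : x =1 y -> mcobound x -> mcobound y.
Proof.
case: k x y => [|k] x y xy /=; first by move=> x0 l; rewrite -xy.
by case=> w xw; exists w => l; rewrite -xy.
Qed.

(** A coboundary over [R_p] has a preimage with a common denominator, and its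
    finitely many entries are equal to those of the given cochain after
    multiplication by one more denominator. *)
Lemma mcobound_frac n k (x : 'I_(mdim (P n) k) -> M) s :
  mcobound (P := P' n) (fun l => loc_frac (x l) s : locmod p M) <->
  exists u : denom p, mcobound (P := P n) (fun l => dval u *: x l).
Proof.
split.
  case: k x => [|k] x /= => [x0|[w' xw']].
    apply: (@common_denom R p _ (fun l u => dval u *: x l = 0)) => [l u t|l].
      by rewrite dvalM mulrC -scalerA => ->; rewrite scaler0.
    exact/(frac_eq0 (x l) s).
  have [t [w wE]] := common_frac w'.
  have [l u v|l|u uP] := @common_denom R p _ (fun l u =>
    (dval u * dval t) *: x l = (dval u * dval s) *: mxact (mdiff (P n) k) w l).
  - move=> E; rewrite dvalM ![dval u * _]mulrC -!mulrA -scalerA E scalerA.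
    by congr (_ *: _); ring.
  - apply/frac_eqP; rewrite xw' -mxact_frac.
    by apply: eq_bigr => j _; rewrite wE.
  exists (denom_mul u t), (fun l => (dval u * dval s) *: w l) => l.
  by rewrite dvalM uP mxactZ.
move=> [u xu]; apply: (@eq_mcobound S _ (P' n) (locmod p M) k (fun l => loc_frac (dval u *: x l) (denom_mul u s))).
  by move=> l; exact: frac_cancel.
case: k x xu => [|k] x /= => [x0 l|[w xw]]; first by rewrite x0 frac0.
exists (fun l => loc_frac (w l) (denom_mul u s)) => l.
by rewrite mxact_frac xw.
Qed.

Local Notation H := (loccoh a i M).
Local Notation H' := (loccoh (loc_ideal p a) i (locmod p M)).

(** A cocycle over [R_p] is a cocycle over [R] divided by a denominator, and the
    coboundary witnessing the annihilation over [R] remains one over [R_p]. *)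
Lemma killed_by_localize (b : ideal R) k :
  killed_by (ideal_exp b k) H -> killed_by (ideal_exp (loc_ideal p b) k) H'.
Proof.
move=> bH r' h' /mem_loc_exp[r rb [t ->]].
have [/(_ h')[n [x' [xc' hE]]] _] := loccoh_annihilators (locmod p M) i T'.
have [s [y yE]] := common_frac x'.
have [l u v|l|u uP] := @common_denom R p _ (fun l u => dval u *: mxact (mdiff (P n) i) y l = 0).
- by rewrite dvalM mulrC -scalerA => ->; rewrite scaler0.
- apply/(frac_eq0 _ s); rewrite -mxact_frac -[RHS](xc' l).
  by apply: eq_bigr => j _; rewrite yE.
have yc : mcocycle (P := P n) (fun l => dval u *: y l) by move=> l; rewrite mxactZ uP.
have [_ /(_ n _ yc)[h hE']] := loccoh_annihilators M i T.
have /hE'[m [nm ym]] := bH r h rb.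
suff rh' : loc_of p r *: h' = 0.
  have -> : loc_frac r t = (loc_frac (1 : R^o) t : locring p) * loc_of p r.
    by rewrite mul_frac scale1r; apply: frac_eq; rewrite dvalM dval1 mulr1.
  by rewrite -scalerA rh' scaler0.
apply/hE; exists m, nm.
have : mcobound (P := P' m) (fun l =>
    loc_frac (mxact (T nm i) (fun l => r *: (dval u *: y l)) l) (denom_mul u s) : locmod p M).
  apply/mcobound_frac; exists (denom1 p); apply: eq_mcobound ym => l.
  by rewrite dval1 scale1r.
apply: eq_mcobound => l; rewrite -mxact_frac; apply: eq_bigr => j _.
by rewrite -scale_loc_of frac_cancel yE.
Qed.

(** The denominator [u] depends on [h]: it clears the denominators of a coboundary
    over [R_p] that witnesses the annihilation of the localised cocycle. *)
Lemma localize_killed_by (b : ideal R) k :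
  killed_by (ideal_exp (loc_ideal p b) k) H' ->
  forall (r : R) (h : H), (r : R^o) \in ideal_exp b k ->
  exists2 u : R, (u : R^o) \notin (p : ideal R) & u *: (r *: h) = 0.
Proof.
move=> bH' r h rb.
have [/(_ h)[n [x [xc hE]]] _] := loccoh_annihilators M i T.
have xc' : mcocycle (P := P' n) (fun l => loc_frac (x l) (denom1 p) : locmod p M).
  by move=> j; rewrite [LHS]mxact_frac xc frac0.
have [_ /(_ n _ xc')[h' hE']] := loccoh_annihilators (locmod p M) i T'.
have rb' : (loc_of p r : (locring p)^o) \in ideal_exp (loc_ideal p b) k.
  by apply/mem_loc_exp; exists r => //; exists (denom1 p).
have /hE'[m [nm rx]] := bH' _ h' rb'.
have /mcobound_frac[u ux] : mcobound (P := P' m) (fun l =>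
    loc_frac (mxact (T nm i) (fun l => r *: x l) l) (denom1 p) : locmod p M).
  apply: eq_mcobound rx => l; rewrite -mxact_frac; apply: eq_bigr => j _.
  by rewrite scale_loc_of.
exists (dval u); first exact: (svalP u).
rewrite scalerA; apply/hE; exists m, nm; apply: eq_mcobound ux => l.
by rewrite -mxactZ; apply: eq_bigr => j _; rewrite [in LHS](scalerA (dval u)).
Qed.

End Cohomology.
End LocalizeResolution.

(** * The local-global principle *)

Lemma inf_nat_Some (A : nat -> Prop) k :
  A k -> (forall j, A j -> (k <= j)%N) -> inf_nat A = Some k.
Proof.
rewrite /inf_nat => Ak kmin; case: pselect => [exA|[]]; last by exists k; apply/asboolP.
case: ex_minnP => m /asboolP Am mmin; congr Some; apply/eqP.
by rewrite eqn_leq kmin // mmin //; apply/asboolP.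
Qed.

Lemma inf_gtP (A : nat -> Prop) r :
  inf_gt (inf_nat A) r <-> forall i, (i <= r)%N -> ~ A i.
Proof.
rewrite /inf_nat; case: pselect => [exA|nA] /=; last first.
  by split=> // _ i _ Ai; apply: nA; exists i; apply/asboolP.
case: ex_minnP => m /asboolP Am mmin; split=> [rm i ir Ai|nA].
  have := mmin i (asboolT Ai).
  by rewrite leqNgt (leq_ltn_trans ir rm).
by rewrite ltnNge; apply/negP => /nA.
Qed.

(** The two sets agree up to [r] and meet that range, so they have the same least
    element. *)
Lemma eq_inf_nat (A B : nat -> Prop) r i : (i <= r)%N -> A i ->
  (forall j, (j <= r)%N -> A j <-> B j) -> inf_nat A = inf_nat B.
Proof.
move=> ir Ai AB.
have exA : exists j, `[< A j >] by exists i; apply/asboolP.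
pose k := ex_minn exA; have [Ak kmin] : A k /\ forall j, A j -> (k <= j)%N.
  rewrite /k; case: ex_minnP => m /asboolP Am mmin; split=> // j Aj.
  by apply: mmin; apply/asboolP.
have kr : (k <= r)%N := leq_trans (kmin i Ai) ir.
rewrite (inf_nat_Some Ak kmin) (@inf_nat_Some B k) //; first exact/AB.
move=> j Bj; have [jr|/ltnW rj] := leqP j r; last exact: leq_trans kr rj.
by apply/kmin/AB.
Qed.

Lemma rel_fin_dim_gt (R : comPzRingType) (a b : ideal R) (M : lmodType R) r :
  inf_gt (rel_fin_dim a b M) r <->
  forall i, (i <= r)%N -> exists n, killed_by (ideal_exp b n) (loccoh a i M).
Proof.
rewrite inf_gtP; split=> H i ir.
  apply: contrapT => nk; apply: (H i ir) => n _; apply: contrapT => nz.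
  apply: nk; exists n => s x sb; apply: contrapT => sx; apply: nz; exists (s *: x).
    by apply: mem_mod_span; apply/asboolP; exists s => //; exists x.
  exact/eqP.
have [n bn] := H i ir => /(_ n.+1 isT)[z zb /negP]; apply.
pose Z : {pred loccoh a i M} := fun z => `[< z = 0 >].
suff /(_ z zb)/asboolP/eqP : {subset smul (ideal_exp b n.+1) (@fullmod R (loccoh a i M)) <= Z} by [].
apply: mod_span_min => [|_ /asboolP[s sb [x _ ->]]].
  split=> [|c x y /asboolP-> /asboolP->]; apply/asboolP => //.
  by rewrite scaler0 addr0.
by apply/asboolP/bn; exact: ideal_exp_decr.
Qed.

Theorem theorem1p3 (R : comPzRingType) (noethR : noetherian R)
    (a b : ideal R) (sub_ba : {subset b <= a})
    (M : lmodType R) (fgM : finitely_generated M)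
    (neq_fc : fin_dim a M <> cofin_dim a b M) (r : nat) :
  (forall p : prime_ideal R,
     inf_gt (rel_fin_dim (loc_ideal p a) (loc_ideal p b) (locmod p M)) r) <->
  inf_gt (rel_fin_dim a b M) r.
Proof.
have P n := some_mresolution noethR (ideal_exp a n.+1).
have T n m nm := some_mlift (@ideal_expS_le R a n m nm) (P m) (P n).
split=> [loc|/rel_fin_dim_gt glob p]; last first.
  apply/rel_fin_dim_gt => i /glob[n bn]; exists n.
  exact: killed_by_localize T b n bn.
pose H i := loccoh a i M.
have main i : (i <= r)%N -> fg_sub (torsion_by b (H i)) ->
    [/\ finitely_generated (H i), cofinite b (H i) & exists n, killed_by (ideal_exp b n) (H i)].
  move=> ir fgT.
  have [p|n bn] := local_global_killed noethR fgT.
    have /rel_fin_dim_gt/(_ i ir)[n bn] := loc p; exists n => s x.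
    exact: localize_killed_by T b n bn s x.
  have fgH := fg_of_killed noethR fgT bn; split=> //; last by exists n.
  by split=> [p|j]; [exact: supp_of_killed bn | exact: fg_Ext].
(* Both properties make [torsion_by b (H i)] finitely generated. *)
have fg_cofin i : (i <= r)%N -> finitely_generated (H i) <-> cofinite b (H i).
  move=> ir; split=> [fgH|[_ fgE]].
    by have [] := main i ir (fg_noeth_mod noethR fgH (torsion_by_closed b (H i))).
  by have [] := main i ir (fg_torsion_by (fgE 0)).
have fgH i : (i <= r)%N -> finitely_generated (H i).
  move=> ir; apply: contrapT => nfg; apply: neq_fc.
  apply: (eq_inf_nat ir nfg) => j /fg_cofin jr.
  by split=> n /jr.
apply/rel_fin_dim_gt => i ir.
by have [] := main i ir (fg_noeth_mod noethR (fgH i ir) (torsion_by_closed b (H i))).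
Qed.
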